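(* Let $k$ be a field, $M$ a finite dimensional $k$-vector space and let $R\in \mathrm{End}_k(M\otimes M)$ be a solution of the Hopf equation, i.e. $R^{23}R^{13}R^{12}=R^{12}R^{23}$ in $\mathrm{End}_k(M\otimes M\otimes M)$. Then: 1. There exists a bialgebra $B(R)$ over $k$ such that $M$ has a structure of $B(R)$-Hopf module $(M,\cdot,\rho)$ and $R=R_{(M,\cdot,\rho)}$. 2. The bialgebra $B(R)$ (together with the structure $(M,\cdot,\rho)$ of part 1) is universal with this property: if $H$ is a bialgebra over $k$ and $(M,\cdot',\rho')$ is an $H$-Hopf module structure on $M$ such that $R=R_{(M,\cdot',\rho')}$, then there exists a unique bialgebra map $f:B(R)\to H$ such that $\rho'=(I\otimes f)\rho$. Furthermore, $a\cdot m=f(a)\cdot' m$ for all $a\in B(R)$, $m\in M$. 3. If $R$ is commutative, i.e. $R^{12}R^{13}=R^{13}R^{12}$, then there exists a commutative bialgebra $\overline{B}(R)$ over $k$ such that $M$ has a structure of $\overline{B}(R)$-Hopf module $(M,\cdot',\rho')$ and $R=R_{(M,\cdot',\rho')}$.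
   Context: $k$ is a field; all vector spaces, algebras (associative, unital), coalgebras and bialgebras are over $k$, and $\otimes=\otimes_k$. For a linear map $R:V\otimes V\to V\otimes V$, the maps $R^{12},R^{23},R^{13}\in\mathrm{End}_k(V\otimes V\otimes V)$ are $R^{12}=R\otimes I$, $R^{23}=I\otimes R$, $R^{13}=(I\otimes\tau)(R\otimes I)(I\otimes\tau)$, where $\tau(v\otimes w)=w\otimes v$ and $I$ is the identity map. Sweedler notation: $\Delta(h)=\sum h_{(1)}\otimes h_{(2)}$ for a bialgebra $H$, and $\rho(m)=\sum m_{<0>}\otimes m_{<1>}\in M\otimes H$ for a right $H$-comodule $(M,\rho)$. Let $H$ be a bialgebra. A (left-right) $H$-Hopf module $(M,\cdot,\rho)$ is a left $H$-module $(M,\cdot)$ which is also a right $H$-comodule $(M,\rho)$ such that $\rho(h\cdot m)=\sum h_{(1)}\cdot m_{<0>}\otimes h_{(2)}m_{<1>}$ for all $h\in H$, $m\in M$. If $(M,\cdot)$ is a left $H$-module and $(M,\rho)$ a right $H$-comodule, then $R_{(M,\cdot,\rho)}:M\otimes M\to M\otimes M$ is the map $R_{(M,\cdot,\rho)}(m\otimes n)=\sum n_{<1>}\cdot m\otimes n_{<0>}$. *)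

(* Defs.v *)
From HB Require Import structures.
From mathcomp Require Import all_boot all_order all_algebra.
From mathcomp Require Import boolp.

Set Implicit Arguments.
Unset Strict Implicit.
Unset Printing Implicit Defensive.

Import GRing.Theory.
Local Open Scope ring_scope.
Local Open Scope quotient_scope.

Reserved Notation "V ⊗ W" (at level 40, left associativity).

Notation is_bilinear f := (bilinear_for *:%R *:%R f).

(******************************************************************************)
(* The tensor product V ⊗ W of vector spaces of arbitrary dimension.          *)
(* A list [:: (v1, w1); ...; (vn, wn)] stands for the formal sum of the pairs *)
(* (vi, wi), with list concatenation as addition; V ⊗ W is the quotient by    *)
(* the congruence generated by commutativity and the bilinearity relations.   *)
(******************************************************************************)

Section TensorProduct.
Variables (k : fieldType) (V W : lmodType k).

Inductive tensor_rel : seq (V * W) -> seq (V * W) -> Prop :=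
| TensorRefl s : tensor_rel s s
| TensorSym s t : tensor_rel s t -> tensor_rel t s
| TensorTrans s t u : tensor_rel s t -> tensor_rel t u -> tensor_rel s u
| TensorCat s s' t t' :
    tensor_rel s s' -> tensor_rel t t' -> tensor_rel (s ++ t) (s' ++ t')
| TensorComm s t : tensor_rel (s ++ t) (t ++ s)
| TensorZero w : tensor_rel [:: (0, w)] [::]
| TensorAddl v v' w : tensor_rel [:: (v + v', w)] [:: (v, w); (v', w)]
| TensorAddr v w w' : tensor_rel [:: (v, w + w')] [:: (v, w); (v, w')]
| TensorScale a v w : tensor_rel [:: (a *: v, w)] [:: (v, a *: w)].

Definition tensor_relb : rel (seq (V * W)) := fun s t => `[< tensor_rel s t >].

Lemma tensor_relb_equiv : equiv_class_of tensor_relb.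
Proof.
split=> [s|s t|t s u]; first by apply/asboolP; exact: TensorRefl.
  by apply/asboolP/asboolP; exact: TensorSym.
by move=> /asboolP st /asboolP tu; apply/asboolP; exact: TensorTrans st tu.
Qed.

Canonical tensor_equiv := EquivRelPack tensor_relb_equiv.

Definition tensor : Type := {eq_quot tensor_equiv}.
HB.instance Definition _ := Choice.on tensor.
HB.instance Definition _ := EqQuotient.on tensor.

Lemma tensor_piP s t : tensor_rel s t <-> \pi_tensor s = \pi_tensor t.
Proof. by split=> [st|/eqmodP/asboolP//]; apply/eqmodP/asboolP. Qed.

Lemma tensor_repr s : tensor_rel (repr (\pi_tensor s)) s.
Proof. by apply/tensor_piP; rewrite reprK. Qed.

Definition pure (v : V) (w : W) : tensor := \pi_tensor [:: (v, w)].

Definition tadd (x y : tensor) : tensor := \pi_tensor (repr x ++ repr y).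
Definition tscale (a : k) (x : tensor) : tensor :=
  \pi_tensor [seq (a *: p.1, p.2) | p <- repr x].

Lemma tadd_pi s t : tadd (\pi_tensor s) (\pi_tensor t) = \pi_tensor (s ++ t).
Proof. by apply/tensor_piP; apply: TensorCat; exact: tensor_repr. Qed.

Lemma tensor_rel_scale a s t : tensor_rel s t ->
  tensor_rel [seq (a *: p.1, p.2) | p <- s] [seq (a *: p.1, p.2) | p <- t].
Proof.
elim=> {s t} /= [s|s t _|s t u _ st _|s s' t t' _ ss' _|s t|w|v v' w|v w w'|b v w].
- exact: TensorRefl.
- exact: TensorSym.
- exact: TensorTrans st.
- by rewrite !map_cat; exact: TensorCat.
- by rewrite !map_cat; exact: TensorComm.
- by rewrite scaler0; exact: TensorZero.
- by rewrite scalerDr; exact: TensorAddl.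
- exact: TensorAddr.
- by rewrite scalerA mulrC -scalerA; exact: TensorScale.
Qed.

Lemma tscale_pi a s :
  tscale a (\pi_tensor s) = \pi_tensor [seq (a *: p.1, p.2) | p <- s].
Proof. by apply/tensor_piP; apply: tensor_rel_scale; exact: tensor_repr. Qed.

Lemma tensor_piW (P : tensor -> Prop) :
  (forall s, P (\pi_tensor s)) -> forall x, P x.
Proof. by move=> Ppi x; rewrite -[x]reprK. Qed.

Lemma taddA : associative tadd.
Proof.
elim/tensor_piW=> s; elim/tensor_piW=> t; elim/tensor_piW=> u.
by rewrite !tadd_pi catA.
Qed.

Lemma taddC : commutative tadd.
Proof.
elim/tensor_piW=> s; elim/tensor_piW=> t; rewrite !tadd_pi.
by apply/tensor_piP; exact: TensorComm.
Qed.

Lemma tadd0 : left_id (\pi_tensor [::]) tadd.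
Proof. by elim/tensor_piW=> s; rewrite tadd_pi. Qed.

Lemma tscaleDl_pi a b x : tscale (a + b) x = tadd (tscale a x) (tscale b x).
Proof.
elim/tensor_piW: x => s; elim: s => [|[v w] s IHs].
  by rewrite !tscale_pi /= tadd_pi.
have E c : tscale c (\pi_tensor ((v, w) :: s)) =
    tadd (\pi_tensor [:: (c *: v, w)]) (tscale c (\pi_tensor s)).
  by rewrite !tscale_pi tadd_pi.
rewrite !E IHs; set x := tscale a _; set y := tscale b _.
have -> : \pi_tensor [:: ((a + b) *: v, w)] =
    tadd (\pi_tensor [:: (a *: v, w)]) (\pi_tensor [:: (b *: v, w)]).
  by rewrite tadd_pi scalerDl; apply/tensor_piP; exact: TensorAddl.
rewrite -!taddA; congr tadd.
by rewrite taddC -taddA; congr tadd; rewrite taddC.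
Qed.

Lemma tscale0_pi x : tscale 0 x = \pi_tensor [::].
Proof.
elim/tensor_piW: x => s; elim: s => [|[v w] s IHs]; first by rewrite tscale_pi.
move: IHs; rewrite !tscale_pi /= scale0r -cat1s -tadd_pi => ->.
by rewrite taddC tadd0; apply/tensor_piP; exact: TensorZero.
Qed.

Lemma tscale1_pi x : tscale 1 x = x.
Proof.
elim/tensor_piW: x => s; rewrite tscale_pi (eq_map (_ : _ =1 id)) ?map_id //.
by case=> v w /=; rewrite scale1r.
Qed.

Lemma taddN : left_inverse (\pi_tensor [::]) (tscale (- 1)) tadd.
Proof.
by move=> x; rewrite -{2}[x]tscale1_pi -tscaleDl_pi addNr tscale0_pi.
Qed.

HB.instance Definition _ := GRing.isZmodule.Build tensor taddA taddC tadd0 taddN.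

Lemma tensor_addE s t : \pi_tensor s + \pi_tensor t = \pi_tensor (s ++ t).
Proof. exact: tadd_pi. Qed.

Lemma tscaleA a b x : tscale a (tscale b x) = tscale (a * b) x.
Proof.
elim/tensor_piW: x => s; rewrite !tscale_pi -map_comp; congr (\pi_tensor _).
by apply: eq_map => -[v w] /=; rewrite scalerA.
Qed.

Lemma tscaleDr : right_distributive tscale +%R.
Proof.
move=> a; elim/tensor_piW=> s; elim/tensor_piW=> t.
by rewrite tensor_addE !tscale_pi map_cat tensor_addE.
Qed.

Lemma tscaleDl x : {morph tscale^~ x : a b / a + b}.
Proof. by move=> a b; exact: tscaleDl_pi. Qed.

HB.instance Definition _ := GRing.Zmodule_isLmodule.Build k tensor
  tscaleA tscale1_pi tscaleDr tscaleDl.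

Lemma tensor_scaleE a s :
  a *: \pi_tensor s = \pi_tensor [seq (a *: p.1, p.2) | p <- s].
Proof. exact: tscale_pi. Qed.

Lemma pure_bilinear : is_bilinear pure.
Proof.
split=> [w a v v'|v a w w'] /=; rewrite /pure tensor_scaleE tensor_addE.
  by apply/tensor_piP; exact: TensorAddl.
apply/tensor_piP; apply: TensorTrans (TensorAddr _ _ _) _.
apply: (@TensorCat [:: _] [:: _]); last exact: TensorRefl.
by apply: TensorSym; exact: TensorScale.
Qed.

HB.instance Definition _ :=
  bilinear_isBilinear.Build k V W tensor *:%R *:%R pure pure_bilinear.

Lemma tensor_ind (P : tensor -> Prop) :
    P 0 -> (forall x y, P x -> P y -> P (x + y)) ->
  (forall v w, P (pure v w)) -> forall x, P x.
Proof.
move=> P0 PD Pp; elim/tensor_piW; elim=> [|[v w] s IHs]; first exact: P0.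
by rewrite -cat1s -tensor_addE; exact: PD (Pp v w) IHs.
Qed.

(* The linear map on V ⊗ W induced by f; it is meaningful for bilinear f only *)
(* (see tliftE and tlift_linear), but the definition makes sense for all f.   *)
Definition tlift (U : lmodType k) (f : V -> W -> U) (x : tensor) : U :=
  \sum_(p <- repr x) f p.1 p.2.

Section Lift.
Variables (U : lmodType k) (f : V -> W -> U).
Hypothesis f_bilin : is_bilinear f.

Lemma tlift_rel s t : tensor_rel s t ->
  \sum_(p <- s) f p.1 p.2 = \sum_(p <- t) f p.1 p.2.
Proof.
have fZl w : scalable (f^~ w) := scalable_linear (f_bilin.1 w).
have fZr v : scalable (f v) := scalable_linear (f_bilin.2 v).
elim=> {s t} //= [s t u _ -> _ -> //|s s' t t' _ ss' _ tt'|s t|w|v v' w|v w w'|a v w].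
- by rewrite !big_cat /= ss' tt'.
- by rewrite !big_cat /= addrC.
- by rewrite big_seq1 big_nil /=; have := fZl w 0 0; rewrite !scale0r.
- rewrite big_seq1 !big_cons big_nil addr0 /=.
  by have := f_bilin.1 w 1 v v'; rewrite /= !scale1r.
- rewrite big_seq1 !big_cons big_nil addr0 /=.
  by have := f_bilin.2 v 1 w w'; rewrite /= !scale1r.
- by rewrite !big_seq1 /= fZl fZr.
Qed.

Lemma tlift_pi s : tlift f (\pi_tensor s) = \sum_(p <- s) f p.1 p.2.
Proof. by apply: tlift_rel; exact: tensor_repr. Qed.

Lemma tliftE v w : tlift f (pure v w) = f v w.
Proof. by rewrite tlift_pi big_seq1. Qed.

Lemma tlift_linear : linear (tlift f).
Proof.
have fZl w : scalable (f^~ w) := scalable_linear (f_bilin.1 w).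
move=> a; elim/tensor_piW=> s; elim/tensor_piW=> t.
rewrite tensor_scaleE tensor_addE !tlift_pi big_cat big_map /=.
by congr (_ + _); rewrite scaler_sumr; apply: eq_bigr => p _; exact: fZl.
Qed.

Lemma tlift0 : tlift f 0 = 0.
Proof. by have := tlift_linear (-1) 0 0; rewrite scaler0 addr0 scaleN1r addNr. Qed.

Lemma tliftD : {morph tlift f : x y / x + y}.
Proof. by move=> x y; have := tlift_linear 1 x y; rewrite !scale1r. Qed.

End Lift.

Lemma tensor_ext (U : lmodType k) (f g : tensor -> U) :
    linear f -> linear g ->
  (forall v w, f (pure v w) = g (pure v w)) -> f =1 g.
Proof.
move=> lf lg fg; pose F := GRing.isLinear.Build k tensor U *:%R f lf.
pose G := GRing.isLinear.Build k tensor U *:%R g lg.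
pose f' : {linear tensor -> U} := HB.pack f F.
pose g' : {linear tensor -> U} := HB.pack g G.
rewrite -[f]/(f' : _ -> _) -[g]/(g' : _ -> _) => x.
by elim/tensor_ind: x => [|x y fx fy|//]; rewrite ?linear0 // !linearD fx fy.
Qed.

End TensorProduct.

Arguments tensor {k} (V W)%_type.
Arguments pure {k V W} (v w)%_R.
Notation "V ⊗ W" := (tensor V W) : type_scope.
Notation "v ⊗ w" := (pure v w) : ring_scope.

Section TensorMaps.
Variable k : fieldType.
Implicit Types U V W : lmodType k.

Definition tmap V V' W W' (f : V -> V') (g : W -> W') : V ⊗ W -> V' ⊗ W' :=
  tlift (fun v w => f v ⊗ g w).

Section TMap.
Variables (V V' W W' : lmodType k).
Variables (f : {linear V -> V'}) (g : {linear W -> W'}).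

Lemma tmap_bilinear : is_bilinear (fun v w => f v ⊗ g w).
Proof.
by split=> [w a v v'|v a w w'] /=; rewrite linearP ?linearPl ?linearPr.
Qed.

Lemma tmapE v w : tmap f g (v ⊗ w) = f v ⊗ g w.
Proof. exact: tliftE tmap_bilinear v w. Qed.

HB.instance Definition _ := GRing.isLinear.Build k (V ⊗ W)%type (V' ⊗ W')%type *:%R
  (tmap f g) (tlift_linear tmap_bilinear).
End TMap.

Definition tflip V W : V ⊗ W -> W ⊗ V := tlift (fun v w => w ⊗ v).

Definition tassoc U V W : (U ⊗ V) ⊗ W -> U ⊗ (V ⊗ W) :=
  tlift (fun x w => tlift (fun u v => u ⊗ (v ⊗ w)) x).

Definition tassocV U V W : U ⊗ (V ⊗ W) -> (U ⊗ V) ⊗ W :=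
  tlift (fun u y => tlift (fun v w => (u ⊗ v) ⊗ w) y).

Section Flip.
Variables V W : lmodType k.

Lemma tflip_bilinear : is_bilinear (fun (v : V) (w : W) => w ⊗ v).
Proof. by split=> [w a v v'|v a w w'] /=; rewrite ?linearPl ?linearPr. Qed.

Lemma tflipE (v : V) (w : W) : tflip (v ⊗ w) = w ⊗ v.
Proof. exact: tliftE tflip_bilinear v w. Qed.

HB.instance Definition _ := GRing.isLinear.Build k (V ⊗ W)%type (W ⊗ V)%type *:%R
  (@tflip V W) (tlift_linear tflip_bilinear).
End Flip.

Section Assoc.
Variables U V W : lmodType k.

Lemma tassoc_bilinear1 (w : W) :
  is_bilinear (fun (u : U) (v : V) => u ⊗ (v ⊗ w)).
Proof. by split=> [v a u u'|u a v v'] /=; rewrite ?linearPl ?linearPr. Qed.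

Lemma tassoc_bilinear : is_bilinear
  (fun (x : U ⊗ V) (w : W) => tlift (fun u v => u ⊗ (v ⊗ w)) x).
Proof.
split=> [w|x a w w'] /=; first exact: tlift_linear (tassoc_bilinear1 w).
elim/tensor_ind: x => [|x y Ex Ey|u v].
- by rewrite !(tlift0 (tassoc_bilinear1 _)) scaler0 addr0.
- rewrite !(tliftD (tassoc_bilinear1 _)) Ex Ey.
  by rewrite scalerDr addrACA.
- by rewrite !tliftE ?linearPr //; exact: tassoc_bilinear1.
Qed.

Lemma tassocE (u : U) (v : V) (w : W) : tassoc ((u ⊗ v) ⊗ w) = u ⊗ (v ⊗ w).
Proof.
rewrite /tassoc (tliftE tassoc_bilinear) tliftE //.
exact: tassoc_bilinear1.
Qed.

HB.instance Definition _ :=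
  GRing.isLinear.Build k ((U ⊗ V) ⊗ W)%type (U ⊗ (V ⊗ W))%type *:%R
    (@tassoc U V W) (tlift_linear tassoc_bilinear).

Lemma tassocV_bilinear1 (u : U) :
  is_bilinear (fun (v : V) (w : W) => (u ⊗ v) ⊗ w).
Proof.
by split=> [w a v v'|v a w w'] /=; rewrite ?linearPr ?linearPl ?linearPr.
Qed.

Lemma tassocV_bilinear : is_bilinear
  (fun (u : U) (y : V ⊗ W) => tlift (fun v w => (u ⊗ v) ⊗ w) y).
Proof.
split=> [y a u u'|u] /=; last exact: tlift_linear (tassocV_bilinear1 u).
elim/tensor_ind: y => [|x y Ex Ey|v w].
- by rewrite !(tlift0 (tassocV_bilinear1 _)) scaler0 addr0.
- rewrite !(tliftD (tassocV_bilinear1 _)) Ex Ey.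
  by rewrite scalerDr addrACA.
- by rewrite !tliftE ?linearPl //; exact: tassocV_bilinear1.
Qed.

Lemma tassocVE (u : U) (v : V) (w : W) : tassocV (u ⊗ (v ⊗ w)) = (u ⊗ v) ⊗ w.
Proof.
rewrite /tassocV (tliftE tassocV_bilinear) tliftE //.
exact: tassocV_bilinear1.
Qed.

HB.instance Definition _ :=
  GRing.isLinear.Build k (U ⊗ (V ⊗ W))%type ((U ⊗ V) ⊗ W)%type *:%R
    (@tassocV U V W) (tlift_linear tassocV_bilinear).
End Assoc.

End TensorMaps.

(******************************************************************************)
(* The ring structure (a ⊗ b) (c ⊗ d) = a c ⊗ b d on A ⊗ B.                   *)
(******************************************************************************)

Section TensorRing.
Variables (k : fieldType) (A B : algType k).

Definition tmul (x y : A ⊗ B) : A ⊗ B :=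
  tlift (fun a b => tmap ( *%R a) ( *%R b) y) x.

Lemma lmul_linear (C : algType k) (a : C) : linear ( *%R a).
Proof. by move=> c x y; rewrite mulrDr scalerAr. Qed.

Lemma tmul_bilinear0 (a : A) (b : B) : is_bilinear (fun c d => (a * c) ⊗ (b * d)).
Proof.
by split=> [d e c c'|c e d d'] /=; rewrite lmul_linear ?linearPl ?linearPr.
Qed.

Lemma tmul_bilinear1 (y : A ⊗ B) :
  is_bilinear (fun (a : A) (b : B) => tmap ( *%R a) ( *%R b) y).
Proof.
split=> [b c a a'|a c b b'] /=; rewrite /tmap; elim/tensor_ind: y => [|x y Ex Ey|v w].
- by rewrite !(tlift0 (tmul_bilinear0 _ _)) scaler0 addr0.
- by rewrite !(tliftD (tmul_bilinear0 _ _)) Ex Ey scalerDr addrACA.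
- rewrite !(tliftE (tmul_bilinear0 _ _)).
  by rewrite mulrDl -scalerAl linearPl.
- by rewrite !(tlift0 (tmul_bilinear0 _ _)) scaler0 addr0.
- by rewrite !(tliftD (tmul_bilinear0 _ _)) Ex Ey scalerDr addrACA.
- rewrite !(tliftE (tmul_bilinear0 _ _)).
  by rewrite mulrDl -scalerAl linearPr.
Qed.

Lemma tmulE a b c d : tmul (a ⊗ b) (c ⊗ d) = (a * c) ⊗ (b * d).
Proof.
by rewrite /tmul (tliftE (tmul_bilinear1 _)) /tmap (tliftE (tmul_bilinear0 _ _)).
Qed.

Lemma tmul_bilinear : is_bilinear tmul.
Proof.
split=> [y|x e y y'] /=; first exact: tlift_linear (tmul_bilinear1 y).
elim/tensor_ind: x => [|x x' Ex Ex'|a b].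
- by rewrite /tmul !(tlift0 (tmul_bilinear1 _)) scaler0 addr0.
- move: Ex Ex'; rewrite /tmul !(tliftD (tmul_bilinear1 _)) => -> ->.
  by rewrite scalerDr addrACA.
- rewrite /tmul !(tliftE (tmul_bilinear1 _)) /tmap.
  exact: (tlift_linear (tmul_bilinear0 a b)).
Qed.

HB.instance Definition _ := bilinear_isBilinear.Build k
  (A ⊗ B)%type (A ⊗ B)%type (A ⊗ B)%type *:%R *:%R tmul tmul_bilinear.

Lemma tmulA : associative tmul.
Proof.
move=> x y z; elim/tensor_ind: x => [|x x' Ex Ex'|a b].
- by rewrite !linear0l.
- by rewrite !linearDl /= Ex Ex'.
elim/tensor_ind: y => [|y y' Ey Ey'|c d].
- by rewrite linear0l linear0r linear0l.
- by rewrite linearDl !linearDr linearDl /= Ey Ey'.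
elim/tensor_ind: z => [|z z' Ez Ez'|e f].
- by rewrite !linear0r.
- by rewrite !linearDr /= Ez Ez'.
by rewrite !tmulE !mulrA.
Qed.

Lemma tmul1l : left_id (1 ⊗ 1) tmul.
Proof.
elim/tensor_ind=> [|x y Ex Ey|a b]; first by rewrite linear0r.
  by rewrite linearDr /= Ex Ey.
by rewrite tmulE !mul1r.
Qed.

Lemma tmul1r : right_id (1 ⊗ 1) tmul.
Proof.
elim/tensor_ind=> [|x y Ex Ey|a b]; first by rewrite linear0l.
  by rewrite linearDl /= Ex Ey.
by rewrite tmulE !mulr1.
Qed.

Lemma tmulDl : left_distributive tmul +%R.
Proof. by move=> x y z; rewrite linearDl. Qed.

Lemma tmulDr : right_distributive tmul +%R.
Proof. by move=> x y z; rewrite linearDr. Qed.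

HB.instance Definition _ := GRing.Zmodule_isPzRing.Build (A ⊗ B)%type
  tmulA tmul1l tmul1r tmulDl tmulDr.

Lemma tensor_mulE (a c : A) (b d : B) : (a ⊗ b) * (c ⊗ d) = (a * c) ⊗ (b * d).
Proof. exact: tmulE. Qed.

Lemma tensor_1E : 1 = 1 ⊗ 1 :> A ⊗ B.
Proof. by []. Qed.

End TensorRing.

(* A bialgebra has 1 != 0 since the counit maps 1 to 1, so it is no loss that *)
(* algType only contains nonzero algebras.                                    *)
HB.mixin Record Algebra_isBialgebra (k : fieldType) H of GRing.Algebra k H := {
  comul : {linear H -> (H ⊗ H)%type};
  counit : {scalar H};
  comul_monoid_morphism : monoid_morphism comul;
  counit_monoid_morphism : monoid_morphism counit;
  comulA : forall h : H,
    tassoc (tmap comul idfun (comul h)) = tmap idfun comul (comul h);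
  comul_counitl : forall h : H,
    tlift (fun h1 h2 => counit h1 *: h2) (comul h) = h;
  comul_counitr : forall h : H,
    tlift (fun h1 h2 => counit h2 *: h1) (comul h) = h
}.

#[short(type="bialgType")]
HB.structure Definition Bialgebra (k : fieldType) :=
  {H of GRing.Algebra k H & Algebra_isBialgebra k H}.

Definition is_coalgebra_map (k : fieldType) (H K : bialgType k)
    (f : {linear H -> K}) : Prop :=
  (forall h, comul (f h) = tmap f f (comul h)) /\
  (forall h, counit (f h) = counit h).

Definition is_bialgebra_map (k : fieldType) (H K : bialgType k)
    (f : {linear H -> K}) : Prop :=
  monoid_morphism f /\ is_coalgebra_map f.

Section HopfModules.
Variables (k : fieldType) (H : bialgType k) (M : lmodType k).
Variables (act : {bilinear H -> M -> M}) (coact : {linear M -> (M ⊗ H)%type}).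

Definition is_left_module : Prop :=
  (forall m, act 1 m = m) /\ (forall g h m, act (g * h) m = act g (act h m)).

Definition is_right_comodule : Prop :=
  (forall m, tassoc (tmap coact idfun (coact m)) = tmap idfun comul (coact m)) /\
  (forall m, tlift (fun m0 m1 => counit m1 *: m0) (coact m) = m).

(* The right-hand side is the sum of h_(1) . m_<0> ⊗ h_(2) m_<1>. *)
Definition hopf_compatible : Prop := forall h m,
  coact (act h m) =
  tlift (fun h1 h2 => tmap (act h1) ( *%R h2) (coact m)) (comul h).

Definition is_hopf_module : Prop :=
  [/\ is_left_module, is_right_comodule & hopf_compatible].

(* m ⊗ n is mapped to the sum of n_<1> . m ⊗ n_<0>. *)
Definition hopf_module_map : M ⊗ M -> M ⊗ M :=
  tlift (fun m n => tlift (fun n0 n1 => act n1 m ⊗ n0) (coact n)).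

Lemma hopf_module_map_bilinear1 (m : M) :
  is_bilinear (fun (n0 : M) (n1 : H) => act n1 m ⊗ n0).
Proof.
by split=> [n1 a n n'|n0 a h h'] /=; rewrite ?linearPl ?linearPr ?linearPl.
Qed.

Lemma hopf_module_map_bilinear : is_bilinear
  (fun m n => tlift (fun (n0 : M) (n1 : H) => act n1 m ⊗ n0) (coact n)).
Proof.
split=> [n a m m'|m a n n'] /=; last first.
  by rewrite linearP (tlift_linear (hopf_module_map_bilinear1 m)).
elim/tensor_ind: (coact n) => [|x y Ex Ey|v w].
- by rewrite !(tlift0 (hopf_module_map_bilinear1 _)) scaler0 addr0.
- rewrite !(tliftD (hopf_module_map_bilinear1 _)) Ex Ey.
  by rewrite scalerDr addrACA.
- by rewrite !(tliftE (hopf_module_map_bilinear1 _)) linearPr linearPl.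
Qed.

Lemma hopf_module_mapE (m n : M) : hopf_module_map (m ⊗ n) =
  tlift (fun n0 n1 => act n1 m ⊗ n0) (coact n).
Proof. exact: tliftE hopf_module_map_bilinear m n. Qed.

End HopfModules.

(******************************************************************************)
(* Maps on the triple tensor power, taken as (M ⊗ M) ⊗ M.                     *)
(******************************************************************************)

Definition map12 (k : fieldType) (M : lmodType k) (R : M ⊗ M -> M ⊗ M) :
    (M ⊗ M) ⊗ M -> (M ⊗ M) ⊗ M :=
  tmap R idfun.

Definition map23 (k : fieldType) (M : lmodType k) (R : M ⊗ M -> M ⊗ M) :
    (M ⊗ M) ⊗ M -> (M ⊗ M) ⊗ M :=
  @tassocV k M M M \o tmap idfun R \o @tassoc k M M M.

Definition map13 (k : fieldType) (M : lmodType k) (R : M ⊗ M -> M ⊗ M) :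
    (M ⊗ M) ⊗ M -> (M ⊗ M) ⊗ M :=
  map23 (@tflip k M M) \o map12 R \o map23 (@tflip k M M).

Definition hopf_equation (k : fieldType) (M : lmodType k)
    (R : M ⊗ M -> M ⊗ M) : Prop :=
  map23 R \o map13 R \o map12 R =1 map12 R \o map23 R.

Definition is_commutative (k : fieldType) (M : lmodType k)
    (R : M ⊗ M -> M ⊗ M) : Prop :=
  map12 R \o map13 R =1 map13 R \o map12 R.

(* Main.v *)
(* Fix a basis (e_i) of M and write R (e_v ⊗ e_u) as the sum of the           *)
(* X_ju(i, v) e_i ⊗ e_j. If a Hopf module structure with coaction             *)
(* rho (e_l) = sum_v e_v ⊗ c_vl induces R, then the comodule axioms give      *)
(* Delta c_il = sum_v c_iv ⊗ c_vl, eps c_il = delta_il; the map R forces      *)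
(* c_ju . e_v = sum_i X_ju(i, v) e_i; and the compatibility of c_ju with e_l  *)
(* becomes                                                                    *)
(*     sum_(p, q) X_jp(i, q) c_pu c_ql = sum_p X_ju(p, l) c_ip.               *)
(* B(R) is the algebra presented by generators c_ij and these relations; the  *)
(* relations are compatible with Delta and eps, and the matrices X_ij satisfy *)
(* them exactly by the Hopf equation, so B(R) is a bialgebra acting on M.     *)
(* If R is commutative then the X_ij commute, so the commutation relations    *)
(* between the c_ij can be added.                                             *)

Require Import Defs.
From HB Require Import structures.
From mathcomp Require Import all_boot all_order all_algebra.
From mathcomp Require Import boolp ring.

Set Implicit Arguments.
Unset Strict Implicit.
Unset Printing Implicit Defensive.

Import GRing.Theory.
Local Open Scope ring_scope.

(** The proof rests on the coefficients c_ij of the coaction in a basis. In the algebra presented by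
    them, every structure map is prescribed on generators, and two points remain each time: the
    prescription respects the relations ([eval_hopf_rel]), and the axiom holds on generators, from
    which it extends to sums and products ([presented_ext], [presented_ind]).

    For the counit the relations are satisfied by the identity matrix ([hopf_rel_eps]). For the
    comultiplication they are applied once in each tensor factor ([hopf_rel_delta]). The action
    sends c_ij to the matrix X_ij, and the relations between these matrices are the Hopf equation
    read entry by entry ([rmx_hopf]). Compatibility of action and coaction at a generator and a
    basis vector is one of the defining relations; it passes to products because H ⊗ H acts on M ⊗ H
    ([tactM], [hopf_compat]).

    Universality reads the same computations backwards. The coefficients d_ij of a coaction over any
    H inducing R satisfy the comatrix formulas ([comodule_coef]), act on M by the X_ij ([act_coef])
    and hence satisfy the relations ([hopf_coef]). So c_ij -> d_ij extends to a bialgebra map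
    ([univ_bialgebra]), and the coaction leaves no other choice on generators ([univ_unique]).

    For the commutative version the generators are also made to commute; M is still a module because
    commutativity of R means that the X_ij commute ([rmx_comm]). *)

(** * Algebras presented by generators and relations *)

Section Terms.
Variables (k : fieldType) (X : Type).

Inductive term :=
| Gen of X
| Const of k
| Add of term & term
| Mul of term & term.

HB.instance Definition _ := gen_eqMixin term.
HB.instance Definition _ := gen_choiceMixin term.

(** The target is a ring with a map from [k], rather than an algebra, so that terms can be evaluated
    in A ⊗ B and in ['M[k]_n] even for n = 0, where it is the zero ring. *)
Fixpoint eval (A : pzRingType) (iota : k -> A) (g : X -> A) (s : term) : A :=
  match s with
  | Gen x => g x
  | Const a => iota a
  | Add s t => eval iota g s + eval iota g t
  | Mul s t => eval iota g s * eval iota g t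
  end.

Lemma eval_sum (A : pzRingType) (iota : {rmorphism k -> A}) (g : X -> A)
    (I : Type) (r : seq I) (F : I -> term) :
  eval iota g (\big[Add/Const 0]_(i <- r) F i) = \sum_(i <- r) eval iota g (F i).
Proof. by apply: big_morph => //=; rewrite rmorph0. Qed.

End Terms.

Section Presentation.
Local Open Scope quotient_scope.
Variables (k : fieldType) (X : Type) (rel : term k X -> term k X -> Prop).
Notation term := (term k X).

(** The ring axioms, the centrality of the constants and the relations are imposed together, so that
    the quotient is the free algebra on [X] modulo the two-sided ideal generated by [rel]. The
    missing right unit law follows from centrality. *)
Inductive cong : term -> term -> Prop :=
| CongRefl s : cong s s
| CongSym s t : cong s t -> cong t s
| CongTrans s t u : cong s t -> cong t u -> cong s u
| CongAdd s s' t t' : cong s s' -> cong t t' -> cong (Add s t) (Add s' t')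
| CongMul s s' t t' : cong s s' -> cong t t' -> cong (Mul s t) (Mul s' t')
| CongAddA s t u : cong (Add s (Add t u)) (Add (Add s t) u)
| CongAddC s t : cong (Add s t) (Add t s)
| CongAdd0 s : cong (Add (Const X 0) s) s
| CongAddN s : cong (Add (Mul (Const X (- 1)) s) s) (Const X 0)
| CongMulA s t u : cong (Mul s (Mul t u)) (Mul (Mul s t) u)
| CongMul1 s : cong (Mul (Const X 1) s) s
| CongMulDl s t u : cong (Mul (Add s t) u) (Add (Mul s u) (Mul t u))
| CongMulDr s t u : cong (Mul s (Add t u)) (Add (Mul s t) (Mul s u))
| CongConstC a s : cong (Mul (Const X a) s) (Mul s (Const X a))
| CongConstD a b : cong (Const X (a + b)) (Add (Const X a) (Const X b))
| CongConstM a b : cong (Const X (a * b)) (Mul (Const X a) (Const X b))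
| CongRel s t : rel s t -> cong s t.

Definition congb : ssrbool.rel term := fun s t => `[< cong s t >].

Lemma congb_equiv : equiv_class_of congb.
Proof.
split=> [s|s t|t s u]; first by apply/asboolP; exact: CongRefl.
  by apply/asboolP/asboolP; exact: CongSym.
by move=> /asboolP st /asboolP tu; apply/asboolP; exact: CongTrans st tu.
Qed.

Canonical cong_equiv := EquivRelPack congb_equiv.

Definition quot : Type := {eq_quot cong_equiv}.
HB.instance Definition _ := Choice.on quot.
HB.instance Definition _ := EqQuotient.on quot.

Lemma quot_piP s t : cong s t <-> \pi_quot s = \pi_quot t.
Proof. by split=> [st|/eqmodP/asboolP//]; apply/eqmodP/asboolP. Qed.

Lemma quot_eq s t : cong s t -> \pi_quot s = \pi_quot t.
Proof. by move/quot_piP. Qed.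

Lemma quot_repr s : cong (repr (\pi_quot s)) s.
Proof. by apply/quot_piP; rewrite reprK. Qed.

Lemma quotW (P : quot -> Prop) : (forall s, P (\pi_quot s)) -> forall x, P x.
Proof. by move=> Ppi x; rewrite -[x]reprK. Qed.

Definition qadd (x y : quot) : quot := \pi_quot (Add (repr x) (repr y)).
Definition qmul (x y : quot) : quot := \pi_quot (Mul (repr x) (repr y)).
Definition qconst (a : k) : quot := \pi_quot (Const X a).
Definition qopp (x : quot) : quot := qmul (qconst (- 1)) x.

Lemma qadd_pi s t : qadd (\pi_quot s) (\pi_quot t) = \pi_quot (Add s t).
Proof. by apply: quot_eq; apply: CongAdd; exact: quot_repr. Qed.

Lemma qmul_pi s t : qmul (\pi_quot s) (\pi_quot t) = \pi_quot (Mul s t).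
Proof. by apply: quot_eq; apply: CongMul; exact: quot_repr. Qed.

Lemma qaddA : associative qadd.
Proof.
elim/quotW=> s; elim/quotW=> t; elim/quotW=> u; rewrite !qadd_pi.
exact/quot_eq/CongAddA.
Qed.

Lemma qaddC : commutative qadd.
Proof.
by elim/quotW=> s; elim/quotW=> t; rewrite !qadd_pi; exact/quot_eq/CongAddC.
Qed.

Lemma qadd0 : left_id (qconst 0) qadd.
Proof. by elim/quotW=> s; rewrite qadd_pi; exact/quot_eq/CongAdd0. Qed.

Lemma qaddN : left_inverse (qconst 0) qopp qadd.
Proof. by elim/quotW=> s; rewrite /qopp qmul_pi qadd_pi; exact/quot_eq/CongAddN. Qed.

HB.instance Definition _ := GRing.isZmodule.Build quot qaddA qaddC qadd0 qaddN.

Lemma qmulA : associative qmul.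
Proof.
elim/quotW=> s; elim/quotW=> t; elim/quotW=> u; rewrite !qmul_pi.
exact/quot_eq/CongMulA.
Qed.

Lemma qconstC a x : qmul (qconst a) x = qmul x (qconst a).
Proof. by elim/quotW: x => s; rewrite !qmul_pi; exact/quot_eq/CongConstC. Qed.

Lemma qmul1l : left_id (qconst 1) qmul.
Proof. by elim/quotW=> s; rewrite qmul_pi; exact/quot_eq/CongMul1. Qed.

Lemma qmul1r : right_id (qconst 1) qmul.
Proof. by move=> x; rewrite -qconstC qmul1l. Qed.

Lemma qmulDl : left_distributive qmul qadd.
Proof.
elim/quotW=> s; elim/quotW=> t; elim/quotW=> u; rewrite !(qmul_pi, qadd_pi).
exact/quot_eq/CongMulDl.
Qed.

Lemma qmulDr : right_distributive qmul qadd.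
Proof.
elim/quotW=> s; elim/quotW=> t; elim/quotW=> u; rewrite !(qmul_pi, qadd_pi).
exact/quot_eq/CongMulDr.
Qed.

HB.instance Definition _ := GRing.Zmodule_isPzRing.Build quot
  qmulA qmul1l qmul1r qmulDl qmulDr.

Lemma quot_addE s t : \pi_quot s + \pi_quot t = \pi_quot (Add s t).
Proof. exact: qadd_pi. Qed.

Lemma quot_mulE s t : \pi_quot s * \pi_quot t = \pi_quot (Mul s t).
Proof. exact: qmul_pi. Qed.

Lemma qconstD a b : qconst (a + b) = qconst a + qconst b.
Proof. by rewrite quot_addE; exact/quot_eq/CongConstD. Qed.

Lemma qconstM a b : qconst (a * b) = qconst a * qconst b.
Proof. by rewrite quot_mulE; exact/quot_eq/CongConstM. Qed.

Definition qscale (a : k) (x : quot) : quot := qconst a * x.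

Lemma qscaleA a b x : qscale a (qscale b x) = qscale (a * b) x.
Proof. by rewrite /qscale mulrA -qconstM. Qed.

Lemma qscale1 : left_id 1 qscale.
Proof. exact: mul1r. Qed.

Lemma qscaleDr : right_distributive qscale +%R.
Proof. by move=> a x y; exact: mulrDr. Qed.

Lemma qscaleDl x : {morph qscale^~ x : a b / a + b}.
Proof. by move=> a b; rewrite /qscale qconstD mulrDl. Qed.

HB.instance Definition _ := GRing.Zmodule_isLmodule.Build k quot
  qscaleA qscale1 qscaleDr qscaleDl.

Lemma quot_scalerAl a (x y : quot) : a *: (x * y) = a *: x * y.
Proof. exact: mulrA. Qed.

Lemma quot_scalerAr a (x y : quot) : a *: (x * y) = x * (a *: y).
Proof. by rewrite [a *: y]qconstC mulrA; exact: qconstC. Qed.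

Section Lift.
Variables (A : pzRingType) (iota : {rmorphism k -> A}) (g : X -> A).
Hypothesis iotaC : forall a x, iota a * x = x * iota a.
Hypothesis g_rel : forall s t, rel s t -> eval iota g s = eval iota g t.

Lemma eval_cong s t : cong s t -> eval iota g s = eval iota g t.
Proof.
elim=> {s t} //=.
- by move=> s t u _ -> _ ->.
- by move=> s s' t t' _ -> _ ->.
- by move=> s s' t t' _ -> _ ->.
- by move=> s t u; rewrite addrA.
- by move=> s t; rewrite addrC.
- by move=> s; rewrite rmorph0 add0r.
- by move=> s; rewrite rmorphN1 mulN1r addNr rmorph0.
- by move=> s t u; rewrite mulrA.
- by move=> s; rewrite rmorph1 mul1r.
- by move=> s t u; rewrite mulrDl.
- by move=> s t u; rewrite mulrDr.
- by move=> a b; rewrite rmorphD.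
- by move=> a b; rewrite rmorphM.
Qed.

(** The value depends on the chosen representative in general; [eval_cong] removes this dependence
    when [iota] is central and [g] respects the relations. *)
Definition quot_lift (x : quot) : A := eval iota g (repr x).

Lemma quot_lift_pi s : quot_lift (\pi_quot s) = eval iota g s.
Proof. by apply: eval_cong; exact: quot_repr. Qed.

Lemma quot_liftD x y : quot_lift (x + y) = quot_lift x + quot_lift y.
Proof.
elim/quotW: x => s; elim/quotW: y => t.
by rewrite quot_addE !quot_lift_pi.
Qed.

Lemma quot_liftM x y : quot_lift (x * y) = quot_lift x * quot_lift y.
Proof.
elim/quotW: x => s; elim/quotW: y => t.
by rewrite quot_mulE !quot_lift_pi.
Qed.

Lemma quot_lift1 : quot_lift 1 = 1.
Proof. by rewrite [LHS]quot_lift_pi /= rmorph1. Qed.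

Lemma quot_liftZ a x : quot_lift (a *: x) = iota a * quot_lift x.
Proof. by rewrite quot_liftM [quot_lift (qconst a)]quot_lift_pi. Qed.

End Lift.
End Presentation.

Section PresentedAlgebra.
Local Open Scope quotient_scope.
Variables (k : fieldType) (X : Type) (rel : term k X -> term k X -> Prop).
Variables (eps : X -> k).
Hypothesis eps_rel : forall s t, rel s t -> eval idfun eps s = eval idfun eps t.

(* The character eps only serves to ensure that 1 != 0. *)
Definition presented of (forall s t, rel s t -> eval idfun eps s = eval idfun eps t) :
  Type := quot rel.

Notation B := (presented eps_rel).
HB.instance Definition _ := GRing.PzRing.on B.
HB.instance Definition _ := GRing.Lmodule.on B.

Definition pres_eps : B -> k := quot_lift idfun eps.

Lemma presented_1neq0 : (1 : B) != 0.
Proof.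
apply/eqP => /(congr1 pres_eps)/eqP; rewrite /pres_eps !quot_lift_pi //=.
  by rewrite oner_eq0.
all: by move=> a x; rewrite mulrC.
Qed.

HB.instance Definition _ :=
  GRing.PzSemiRing_isNonZero.Build B presented_1neq0.
HB.instance Definition _ :=
  GRing.Lmodule_isLalgebra.Build k B (@quot_scalerAl k X rel).
HB.instance Definition _ :=
  GRing.Lalgebra_isAlgebra.Build k B (@quot_scalerAr k X rel).

Definition gen (x : X) : B := \pi_(quot rel) (Gen k x).

Lemma presented_ind (P : B -> Prop) :
    (forall x, P (gen x)) -> (forall a, P a%:A) ->
    (forall x y, P x -> P y -> P (x + y)) ->
    (forall x y, P x -> P y -> P (x * y)) ->
  forall x, P x.
Proof.
move=> Pg Pc PD PM; elim/quotW; elim=> [x|a|s Ps t Pt|s Ps t Pt].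
- exact: Pg.
- suff -> : \pi_(quot rel) (Const X a) = (a%:A : B) by exact: Pc.
  by rewrite [RHS]mulr1.
- by rewrite -quot_addE; exact: PD.
- by rewrite -quot_mulE; exact: PM.
Qed.

Lemma eval_gen s : eval (in_alg B) gen s = \pi_(quot rel) s.
Proof.
elim: s => //= [a|s -> t ->|s -> t ->]; first by rewrite [LHS]mulr1.
- exact: quot_addE.
- exact: quot_mulE.
Qed.

Lemma gen_rel s t : rel s t -> eval (in_alg B) gen s = eval (in_alg B) gen t.
Proof. by move=> st; rewrite !eval_gen; exact/quot_eq/CongRel. Qed.

End PresentedAlgebra.
Arguments pres_eps {k X rel eps} eps_rel x.

(** * Tensor products of algebras *)

Section TensorAlgebra.
Variable k : fieldType.

Definition linear_pack (U V : lmodType k) (f : U -> V) (lf : linear f) :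
  {linear U -> V} := HB.pack f (GRing.isLinear.Build k U V *:%R f lf).

Definition tlift_lin (V W U : lmodType k) (f : V -> W -> U)
  (f_bilin : is_bilinear f) : {linear (V ⊗ W)%type -> U} :=
  linear_pack (tlift_linear f_bilin).
Arguments tlift_lin : simpl never.

Lemma tlift_linE (V W U : lmodType k) (f : V -> W -> U)
  (f_bilin : is_bilinear f) v w : tlift_lin f_bilin (v ⊗ w) = f v w.
Proof. exact: tliftE. Qed.

Lemma tensor_scalerAl (A B : algType k) a (x y : (A ⊗ B)%type) :
  a *: (x * y) = (a *: x) * y.
Proof. by rewrite [RHS]linearZl_LR. Qed.

Lemma tensor_scalerAr (A B : algType k) a (x y : (A ⊗ B)%type) :
  a *: (x * y) = x * (a *: y).
Proof. by rewrite [RHS]linearZr_LR. Qed.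

(** The structure map of the algebra A ⊗ B, in the form that [eval] needs to define the
    comultiplication. *)
Definition tconst (A B : algType k) (a : k) : (A ⊗ B)%type := a *: (1 : (A ⊗ B)%type).

Section TConst.
Variables A B : algType k.

Lemma tconst_zmod : zmod_morphism (@tconst A B).
Proof. by move=> a b; rewrite /tconst scalerBl. Qed.

Lemma tconst_monoid : monoid_morphism (@tconst A B).
Proof.
split=> [|a b]; rewrite /tconst ?scale1r //.
by rewrite -tensor_scalerAl mul1r scalerA.
Qed.

HB.instance Definition _ := GRing.isZmodMorphism.Build k (A ⊗ B)%type
  (@tconst A B) tconst_zmod.
HB.instance Definition _ := GRing.isMonoidMorphism.Build k (A ⊗ B)%type
  (@tconst A B) tconst_monoid.

Lemma tconstE a (x : (A ⊗ B)%type) : tconst A B a * x = a *: x.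
Proof. by rewrite -tensor_scalerAl mul1r. Qed.

Lemma tconstC a (x : (A ⊗ B)%type) : tconst A B a * x = x * tconst A B a.
Proof. by rewrite tconstE -tensor_scalerAr mulr1. Qed.
End TConst.

Lemma tmap_monoid (A A' B B' : algType k) (f : {linear A -> A'})
    (g : {linear B -> B'}) :
  monoid_morphism f -> monoid_morphism g -> monoid_morphism (tmap f g).
Proof.
case=> f1 fM [g1 gM]; split=> [|x y].
  by rewrite !tensor_1E tmapE f1 g1.
elim/tensor_ind: x => [|x x' Ex Ex'|a b].
- by rewrite mul0r linear0 mul0r.
- by rewrite mulrDl !linearD mulrDl /= Ex Ex'.
elim/tensor_ind: y => [|y y' Ey Ey'|c d].
- by rewrite mulr0 linear0 mulr0.
- by rewrite mulrDr !linearD mulrDr /= Ey Ey'.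
by rewrite tensor_mulE !tmapE fM gM tensor_mulE.
Qed.

Lemma scale_bilinear (V W : lmodType k) (f : {scalar V}) :
  is_bilinear (fun (v : V) (w : W) => f v *: w).
Proof.
split=> [w a v v'|v a w w'] /=; first by rewrite linearP scalerDl scalerA.
by rewrite scalerDr !scalerA mulrC.
Qed.

Lemma scaler_bilinear (V W : lmodType k) (f : {scalar W}) :
  is_bilinear (fun (v : V) (w : W) => f w *: v).
Proof.
split=> [w a v v'|v a w w'] /=; last by rewrite linearP scalerDl scalerA.
by rewrite scalerDr !scalerA mulrC.
Qed.

(** The map is f ⊗ id followed by the identification of k ⊗ B with B. With f the counit, this
    reduces the left counit axiom to generators. *)
Lemma scale_tlift_mul (A B : algType k) (f : {scalar A}) :
    monoid_morphism f ->
  monoid_morphism (tlift (fun (a : A) (b : B) => f a *: b)).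
Proof.
case=> f1 fM; split=> [|x y].
  by rewrite tensor_1E (tliftE (scale_bilinear _ f)) f1 scale1r.
pose F := tlift_lin (scale_bilinear B f); rewrite -![tlift _]/(F : _ -> _) /F.
elim/tensor_ind: x => [|x x' Ex Ex'|a b].
- by rewrite mul0r linear0 mul0r.
- by rewrite mulrDl !linearD mulrDl Ex Ex'.
elim/tensor_ind: y => [|y y' Ey Ey'|c d].
- by rewrite mulr0 linear0 mulr0.
- by rewrite mulrDr !linearD mulrDr Ey Ey'.
rewrite tensor_mulE !tlift_linE fM.
by rewrite -scalerAl -scalerAr scalerA.
Qed.

Lemma scaler_tlift_mul (A B : algType k) (f : {scalar B}) :
    monoid_morphism f ->
  monoid_morphism (tlift (fun (a : A) (b : B) => f b *: a)).
Proof.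
case=> f1 fM; split=> [|x y].
  by rewrite tensor_1E (tliftE (scaler_bilinear _ f)) f1 scale1r.
pose F := tlift_lin (scaler_bilinear A f); rewrite -![tlift _]/(F : _ -> _) /F.
elim/tensor_ind: x => [|x x' Ex Ex'|a b].
- by rewrite mul0r linear0 mul0r.
- by rewrite mulrDl !linearD mulrDl Ex Ex'.
elim/tensor_ind: y => [|y y' Ey Ey'|c d].
- by rewrite mulr0 linear0 mulr0.
- by rewrite mulrDr !linearD mulrDr Ey Ey'.
rewrite tensor_mulE !tlift_linE fM.
by rewrite -scalerAl -scalerAr scalerA.
Qed.

End TensorAlgebra.

(** * Maps out of a presented algebra, and its tensor powers *)

Section PresentedMaps.
Variables (k : fieldType) (X : Type) (rel : term k X -> term k X -> Prop).
Variables (eps : X -> k).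
Hypothesis eps_rel : forall s t, rel s t -> eval idfun eps s = eval idfun eps t.
Notation B := (presented eps_rel).

(** The product of the target is passed as a bare operation, so that the same statement serves
    algebras and their tensor products. *)
Lemma presented_ext (V : lmodType k) (mul : V -> V -> V) (f g : {linear B -> V}) :
    f 1 = g 1 ->
    {morph f : x y / x * y >-> mul x y} -> {morph g : x y / x * y >-> mul x y} ->
  (forall x, f (gen eps_rel x) = g (gen eps_rel x)) -> f =1 g.
Proof.
move=> fg1 fM gM fg; elim/presented_ind=> [//|a|x y Ex Ey|x y Ex Ey].
- by rewrite !linearZ fg1.
- by rewrite !linearD Ex Ey.
- by rewrite fM gM Ex Ey.
Qed.

Lemma pres_eps_linear : scalar (pres_eps eps_rel).
Proof.
move=> a x y; rewrite /pres_eps quot_liftD ?quot_liftZ //.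
all: by move=> ? ?; rewrite mulrC.
Qed.

HB.instance Definition _ :=
  GRing.isLinear.Build k B k *%R (pres_eps eps_rel) pres_eps_linear.

Lemma pres_eps_monoid : monoid_morphism (pres_eps eps_rel).
Proof.
split=> [|x y]; rewrite /pres_eps ?quot_lift1 ?quot_liftM //.
all: by move=> ? ?; rewrite mulrC.
Qed.

Lemma pres_eps_gen x : pres_eps eps_rel (gen eps_rel x) = eps x.
Proof. by rewrite /pres_eps quot_lift_pi //= => ? ?; rewrite mulrC. Qed.

(** The map eps ⊗ id sends 1 ⊗ 1 to 1. Nontriviality makes B ⊗ B an [algType], so that the triple
    tensor products in coassociativity are rings in turn. *)
Lemma presented_tensor_1neq0 : (1 : (B ⊗ B)%type) != 0.
Proof.
have [eps1 _] := pres_eps_monoid.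
apply/eqP => /(congr1 (tlift_lin (scale_bilinear B (pres_eps eps_rel : {scalar B})))).
rewrite linear0 tensor_1E tlift_linE /= eps1 scale1r.
by move/eqP; rewrite oner_eq0.
Qed.

HB.instance Definition _ :=
  GRing.PzSemiRing_isNonZero.Build (B ⊗ B)%type presented_tensor_1neq0.
HB.instance Definition _ :=
  GRing.Lmodule_isLalgebra.Build k (B ⊗ B)%type (@tensor_scalerAl k B B).
HB.instance Definition _ :=
  GRing.Lalgebra_isAlgebra.Build k (B ⊗ B)%type (@tensor_scalerAr k B B).

Lemma tassoc_mul (x y : ((B ⊗ B) ⊗ B)%type) :
  tassoc (x * y) = tassoc x * tassoc y :> (B ⊗ (B ⊗ B))%type.
Proof.
elim/tensor_ind: x => [|x x' Ex Ex'|x c].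
- by rewrite mul0r linear0 mul0r.
- by rewrite mulrDl !linearD mulrDl /= Ex Ex'.
elim/tensor_ind: y => [|y y' Ey Ey'|y d].
- by rewrite mulr0 linear0 mulr0.
- by rewrite mulrDr !linearD mulrDr /= Ey Ey'.
elim/tensor_ind: x => [|x x' Ex Ex'|a b].
- by rewrite linear0l !(mul0r, linear0).
- by rewrite !linearDl linearD [RHS]mulrDl -Ex -Ex' -linearD -mulrDl.
elim/tensor_ind: y => [|y y' Ey Ey'|a' b'].
- by rewrite linear0l !(mulr0, linear0).
- by rewrite !linearDl linearD [RHS]mulrDr -Ey -Ey' -linearD -mulrDr.
by rewrite !(tensor_mulE, tassocE).
Qed.

End PresentedMaps.

(** * Bialgebras generated by a comatrix coalgebra *)

Section ComatrixBialgebra.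
Variables (k : fieldType) (n : nat).
Notation X := ('I_n * 'I_n)%type.
Variable rel : term k X -> term k X -> Prop.

Definition comatrix_eps (p : X) : k := (p.1 == p.2)%:R.

Hypothesis eps_rel : forall s t, rel s t ->
  eval idfun comatrix_eps s = eval idfun comatrix_eps t.
Notation B := (presented eps_rel).
Notation c i j := (gen eps_rel (i, j)).

(** With [comatrix_eps], this is the comatrix coalgebra, dual to the algebra of n x n matrices. *)
Definition comatrix_delta (p : X) : (B ⊗ B)%type := \sum_u c p.1 u ⊗ c u p.2.

Hypothesis delta_rel : forall s t, rel s t ->
  eval (tconst B B) comatrix_delta s = eval (tconst B B) comatrix_delta t.

(** The proof that the comultiplication respects the relations is a parameter of the type, so that
    the bialgebra structure can be attached to the type itself. *)
Definition comatrix_bialgebra of (forall s t, rel s t ->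
  eval (tconst B B) comatrix_delta s = eval (tconst B B) comatrix_delta t) : Type := B.

Definition pres_delta (x : B) : (B ⊗ B)%type :=
  quot_lift (tconst B B) comatrix_delta x.

Lemma pres_delta_linear : linear pres_delta.
Proof.
move=> a x y; rewrite /pres_delta quot_liftD ?quot_liftZ ?tconstE //.
all: exact: tconstC.
Qed.

Lemma pres_delta_monoid : monoid_morphism pres_delta.
Proof.
by split=> [|x y]; rewrite /pres_delta ?quot_lift1 ?quot_liftM //; exact: tconstC.
Qed.

Lemma pres_delta_gen i j : pres_delta (c i j) = \sum_u c i u ⊗ c u j.
Proof. by rewrite /pres_delta quot_lift_pi //; exact: tconstC. Qed.

HB.instance Definition _ :=
  GRing.isLinear.Build k B (B ⊗ B)%type *:%R pres_delta pres_delta_linear.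

Lemma idfun_monoid (A : algType k) : monoid_morphism (idfun : A -> A).
Proof. by []. Qed.

(** Both sides are algebra maps, the left one by [tassoc_mul], and on c_ij both are the sum of the
    c_iu ⊗ (c_uw ⊗ c_wj). *)
Lemma pres_deltaA (h : B) :
  tassoc (tmap pres_delta idfun (pres_delta h)) = tmap idfun pres_delta (pres_delta h).
Proof.
have DM := pres_delta_monoid; have [_ DMM] := DM.
have [l1 lM] := tmap_monoid DM (idfun_monoid B).
have [r1 rM] := tmap_monoid (idfun_monoid B) DM.
pose F : {linear B -> (B ⊗ (B ⊗ B))%type} :=
  (@tassoc k B B B \o tmap pres_delta idfun) \o pres_delta.
pose G : {linear B -> (B ⊗ (B ⊗ B))%type} := tmap idfun pres_delta \o pres_delta.
apply: (presented_ext (f := F) (g := G)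
  (mul := fun x y : (B ⊗ (B ⊗ B))%type => x * y)) => {h} [|x y|x y|[i j]].
- by rewrite /F /G /= DM.1 l1 r1 !tensor_1E tassocE.
- by rewrite /F /= DMM lM tassoc_mul.
- by rewrite /G /= DMM rM.
rewrite /F /G /= pres_delta_gen.
rewrite ![tmap _ _ (\sum_(_ < _) _)]linear_sum linear_sum.
under eq_bigr => u _ do
  rewrite /= tmapE /= pres_delta_gen linear_sumlz linear_sum /=.
rewrite exchange_big /=; apply: eq_bigr => u _.
rewrite /= tmapE /= pres_delta_gen linear_sumr.
by apply: eq_bigr => w _; rewrite tassocE.
Qed.

Lemma pres_counitl (h : B) :
  tlift (fun h1 h2 => pres_eps eps_rel h1 *: h2) (pres_delta h) = h.
Proof.
have DM := pres_delta_monoid.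
have [l1 lM] := scale_tlift_mul B (pres_eps_monoid eps_rel).
pose bil := scale_bilinear B (pres_eps eps_rel : {scalar B}).
pose F : {linear B -> B} := tlift_lin bil \o pres_delta.
apply: (presented_ext (f := F) (g := idfun)
  (mul := fun x y : B => x * y)) => {h} [|x y|x y|[i j]] //.
- by rewrite /F /= DM.1 l1.
- by rewrite /F /= DM.2 lM.
rewrite /F /= pres_delta_gen -[tlift _]/(tlift_lin bil : _ -> _) linear_sum /=.
rewrite (bigD1 i) //= big1 ?addr0 => [|u ui].
  by rewrite (tliftE bil) /= pres_eps_gen /comatrix_eps eqxx scale1r.
rewrite (tliftE bil) /= pres_eps_gen /comatrix_eps /= eq_sym (negbTE ui).
by rewrite scale0r.
Qed.

Lemma pres_counitr (h : B) :
  tlift (fun h1 h2 => pres_eps eps_rel h2 *: h1) (pres_delta h) = h.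
Proof.
have DM := pres_delta_monoid.
have [l1 lM] := scaler_tlift_mul B (pres_eps_monoid eps_rel).
pose bil := scaler_bilinear B (pres_eps eps_rel : {scalar B}).
pose F : {linear B -> B} := tlift_lin bil \o pres_delta.
apply: (presented_ext (f := F) (g := idfun)
  (mul := fun x y : B => x * y)) => {h} [|x y|x y|[i j]] //.
- by rewrite /F /= DM.1 l1.
- by rewrite /F /= DM.2 lM.
rewrite /F /= pres_delta_gen -[tlift _]/(tlift_lin bil : _ -> _) linear_sum /=.
rewrite (bigD1 j) //= big1 ?addr0 => [|u uj].
  by rewrite (tliftE bil) /= pres_eps_gen /comatrix_eps eqxx scale1r.
by rewrite (tliftE bil) /= pres_eps_gen /comatrix_eps /= (negbTE uj) scale0r.
Qed.

HB.instance Definition _ := GRing.Algebra.on (comatrix_bialgebra delta_rel).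
HB.instance Definition _ := Algebra_isBialgebra.Build k
  (comatrix_bialgebra delta_rel)
  pres_delta_monoid (pres_eps_monoid eps_rel) pres_deltaA pres_counitl pres_counitr.

End ComatrixBialgebra.

(** * The action of H ⊗ H on M ⊗ H *)

Section TensorAction.
Variables (k : fieldType) (H : algType k) (M : lmodType k).
Variable act : {bilinear H -> M -> M}.

(** Hopf compatibility says that coacting after the action of h is [tact] by the comultiplication of
    h after coacting. *)
Definition tact (y : (H ⊗ H)%type) (z : (M ⊗ H)%type) : (M ⊗ H)%type :=
  tlift (fun h1 h2 => tmap (act h1) ( *%R h2) z) y.

Lemma tact_bilinear0 (g h : H) : is_bilinear (fun m b => act g m ⊗ (h * b)).
Proof.
split=> [b a m m'|m a b b'] /=; first by rewrite linearPr linearPl.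
by rewrite lmul_linear linearPr.
Qed.

Lemma tact_bilinear1 (z : (M ⊗ H)%type) :
  is_bilinear (fun h1 h2 : H => tmap (act h1) ( *%R h2) z).
Proof.
split=> [b c a a'|a c b b'] /=; rewrite /tmap; elim/tensor_ind: z => [|x y Ex Ey|v w].
- by rewrite !(tlift0 (tact_bilinear0 _ _)) scaler0 addr0.
- by rewrite !(tliftD (tact_bilinear0 _ _)) Ex Ey scalerDr addrACA.
- by rewrite !(tliftE (tact_bilinear0 _ _)) linearPl linearPl.
- by rewrite !(tlift0 (tact_bilinear0 _ _)) scaler0 addr0.
- by rewrite !(tliftD (tact_bilinear0 _ _)) Ex Ey scalerDr addrACA.
- rewrite !(tliftE (tact_bilinear0 _ _)).
  by rewrite mulrDl -scalerAl linearPr.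
Qed.

Lemma tactE g h m b : tact (g ⊗ h) (m ⊗ b) = act g m ⊗ (h * b).
Proof.
by rewrite /tact (tliftE (tact_bilinear1 _)) /tmap (tliftE (tact_bilinear0 _ _)).
Qed.

Lemma tact_bilinear : is_bilinear tact.
Proof.
split=> [y|x e y y'] /=; first exact: tlift_linear (tact_bilinear1 y).
elim/tensor_ind: x => [|x x' Ex Ex'|a b].
- by rewrite /tact !(tlift0 (tact_bilinear1 _)) scaler0 addr0.
- move: Ex Ex'; rewrite /tact !(tliftD (tact_bilinear1 _)) => -> ->.
  by rewrite scalerDr addrACA.
- rewrite /tact !(tliftE (tact_bilinear1 _)) /tmap.
  exact: (tlift_linear (tact_bilinear0 a b)).
Qed.

HB.instance Definition _ := bilinear_isBilinear.Build k
  (H ⊗ H)%type (M ⊗ H)%type (M ⊗ H)%type *:%R *:%R tact tact_bilinear.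

Hypothesis act1 : forall m, act 1 m = m.
Hypothesis actM : forall g h m, act (g * h) m = act g (act h m).

Lemma tact1 z : tact 1 z = z.
Proof.
elim/tensor_ind: z => [|x y Ex Ey|v w]; first by rewrite linear0r.
  by rewrite linearDr /= Ex Ey.
by rewrite tensor_1E tactE act1 mul1r.
Qed.

(** This makes Hopf compatibility stable under products in H. *)
Lemma tactM x y z : tact (x * y) z = tact x (tact y z).
Proof.
elim/tensor_ind: x => [|x x' Ex Ex'|a b].
- by rewrite mul0r !linear0l.
- by rewrite mulrDl !linearDl /= Ex Ex'.
elim/tensor_ind: y => [|y y' Ey Ey'|c d].
- by rewrite mulr0 !linear0l linear0r.
- by rewrite mulrDr !linearDl linearDr /= Ey Ey'.
elim/tensor_ind: z => [|z z' Ez Ez'|m h].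
- by rewrite !linear0r.
- by rewrite !linearDr /= Ez Ez'.
by rewrite tensor_mulE !tactE actM mulrA.
Qed.

End TensorAction.

Lemma sum_deltar (S : pzSemiRingType) (I : finType) (F : I -> S) j :
  \sum_i F i * (i == j)%:R = F j.
Proof.
rewrite (bigD1 j) //= eqxx mulr1 big1 ?addr0 // => i /negbTE ->.
by rewrite mulr0.
Qed.

Lemma sum_deltal (S : pzSemiRingType) (I : finType) (F : I -> S) j :
  \sum_i (j == i)%:R * F i = F j.
Proof.
rewrite (bigD1 j) //= eqxx mul1r big1 ?addr0 // => i.
by rewrite eq_sym => /negbTE ->; rewrite mul0r.
Qed.

(** * Coordinates of the Hopf equation *)

Section Basis.
Variables (k : fieldType) (M : lmodType k) (n : nat).
Variables (e : 'I_n -> M) (co : 'I_n -> {scalar M}).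

(** Finite dimensionality of M enters the argument only through such a basis and its coordinate
    functionals. *)
Definition dual_bases : Prop :=
  (forall i j, co i (e j) = (i == j)%:R) /\
  (forall m, m = \sum_i co i m *: e i).

Hypothesis base : dual_bases.

Lemma basis_ext (V : lmodType k) (f g : {linear M -> V}) :
  (forall i, f (e i) = g (e i)) -> f =1 g.
Proof.
move=> fg m; rewrite (base.2 m) !linear_sum.
by apply: eq_bigr => i _; rewrite !linearZ /= fg.
Qed.

Definition tcoordl (V : lmodType k) i : {linear (M ⊗ V)%type -> V} :=
  tlift_lin (scale_bilinear V (co i)).
Definition tcoordr (V : lmodType k) i : {linear (V ⊗ M)%type -> V} :=
  tlift_lin (scaler_bilinear V (co i)).

Lemma tcoordlE (V : lmodType k) i m (v : V) : tcoordl V i (m ⊗ v) = co i m *: v.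
Proof. exact: tlift_linE. Qed.

Lemma tcoordrE (V : lmodType k) i (v : V) m : tcoordr V i (v ⊗ m) = co i m *: v.
Proof. exact: tlift_linE. Qed.

(** With [tcoordl_sum] this identifies M ⊗ V with n copies of V, so that equations in M ⊗ V can be
    compared coefficient by coefficient. *)
Lemma tensor_coordl (V : lmodType k) (x : (M ⊗ V)%type) :
  x = \sum_i e i ⊗ tcoordl V i x.
Proof.
elim/tensor_ind: x => [|x y Ex Ey|m v].
- by rewrite big1 // => i _; rewrite !linear0 linear0r.
- rewrite {1}Ex {1}Ey -big_split; apply: eq_bigr => i _.
  by rewrite linearD [RHS]linearDr.
rewrite {1}(base.2 m) linear_sumlz; apply: eq_bigr => i _.
by rewrite tcoordlE linearZl_LR linearZr_LR.
Qed.

Lemma tensor_coordr (V : lmodType k) (x : (V ⊗ M)%type) :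
  x = \sum_i tcoordr V i x ⊗ e i.
Proof.
elim/tensor_ind: x => [|x y Ex Ey|v m].
- by rewrite big1 // => i _; rewrite !linear0 linear0l.
- rewrite {1}Ex {1}Ey -big_split; apply: eq_bigr => i _.
  by rewrite linearD [RHS]linearDl.
rewrite {1}(base.2 m) linear_sumr; apply: eq_bigr => i _.
by rewrite tcoordrE linearZl_LR linearZr_LR.
Qed.

Lemma tcoordl_sum (V : lmodType k) (F : 'I_n -> V) j :
  tcoordl V j (\sum_i e i ⊗ F i) = F j.
Proof.
rewrite linear_sum (bigD1 j) // big1 => [|i ij].
  by rewrite tcoordlE base.1 eqxx scale1r /= addr0.
by rewrite tcoordlE base.1 eq_sym (negbTE ij) scale0r.
Qed.

Lemma tcoordr_sum (V : lmodType k) (F : 'I_n -> V) j :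
  tcoordr V j (\sum_i F i ⊗ e i) = F j.
Proof.
rewrite linear_sum (bigD1 j) // big1 => [|i ij].
  by rewrite tcoordrE base.1 eqxx scale1r /= addr0.
by rewrite tcoordrE base.1 eq_sym (negbTE ij) scale0r.
Qed.

Definition mxact (A : 'M[k]_n) (m : M) : M :=
  \sum_i (\sum_j A i j * co j m) *: e i.

Lemma mxact_bilinear : is_bilinear mxact.
Proof.
split=> [m a A A'|A a m m'] /=; rewrite /mxact scaler_sumr -big_split /=;
  apply: eq_bigr => i _; rewrite scalerA -scalerDl mulr_sumr -big_split /=;
  congr (_ *: _); apply: eq_bigr => j _.
  by rewrite !mxE mulrDl mulrA.
by rewrite linearP mulrDr mulrCA.
Qed.

Lemma mxact_basis A v : mxact A (e v) = \sum_i A i v *: e i.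
Proof.
apply: eq_bigr => i _; congr (_ *: _).
by under eq_bigr => j _ do rewrite base.1; rewrite sum_deltar.
Qed.

Lemma co_mxact A i m : co i (mxact A m) = \sum_j A i j * co j m.
Proof.
rewrite /mxact linear_sum /=; under eq_bigr => l _ do
  rewrite linearZ /= base.1 eq_sym.
by rewrite sum_deltar.
Qed.

Lemma mxact1 m : mxact 1 m = m.
Proof.
rewrite [RHS]base.2; apply: eq_bigr => i _; congr (_ *: _).
by under eq_bigr => j _ do rewrite mxE; rewrite sum_deltal.
Qed.

Lemma mxactM A A' m : mxact (A * A') m = mxact A (mxact A' m).
Proof.
apply: eq_bigr => i _; congr (_ *: _).
under [RHS]eq_bigr => j _ do rewrite co_mxact mulr_sumr.
rewrite exchange_big; apply: eq_bigr => l _.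
by rewrite mxE mulr_suml; apply: eq_bigr => j _; rewrite mulrA.
Qed.

Section Operator.
Variable R : {linear (M ⊗ M)%type -> (M ⊗ M)%type}.

(* R (e_v ⊗ e_u) is the sum of the rmx j u i v *: (e_i ⊗ e_j). *)
Definition rmx (j u : 'I_n) : 'M[k]_n :=
  \matrix_(i, v) co i (tcoordr M j (R (e v ⊗ e u))).

Lemma tcoordr_rmx j u v :
  tcoordr M j (R (e v ⊗ e u)) = \sum_i rmx j u i v *: e i.
Proof. by rewrite [LHS]base.2; apply: eq_bigr => i _; rewrite mxE. Qed.

Lemma R_basis v u : R (e v ⊗ e u) = \sum_i \sum_j rmx j u i v *: (e i ⊗ e j).
Proof.
rewrite [LHS]tensor_coordr exchange_big; apply: eq_bigr => j _.
rewrite tcoordr_rmx linear_sumlz; apply: eq_bigr => i _.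
by rewrite linearZl_LR.
Qed.

Lemma map12_linear : linear (map12 R).
Proof. by move=> a x y; rewrite /map12 linearP. Qed.
HB.instance Definition _ := GRing.isLinear.Build k
  ((M ⊗ M) ⊗ M)%type ((M ⊗ M) ⊗ M)%type *:%R (map12 R) map12_linear.

Lemma map23_linear : linear (map23 R).
Proof. by move=> a x y; rewrite /map23 /= !linearP. Qed.
HB.instance Definition _ := GRing.isLinear.Build k
  ((M ⊗ M) ⊗ M)%type ((M ⊗ M) ⊗ M)%type *:%R (map23 R) map23_linear.
End Operator.

Section Operator13.
Variable R : {linear (M ⊗ M)%type -> (M ⊗ M)%type}.

Lemma map13_linear : linear (map13 R).
Proof. by move=> a x y; rewrite /map13 /= !linearP. Qed.
HB.instance Definition _ := GRing.isLinear.Build k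
  ((M ⊗ M) ⊗ M)%type ((M ⊗ M) ⊗ M)%type *:%R (map13 R) map13_linear.

Notation X := (rmx R).
Definition e3 a b c : ((M ⊗ M) ⊗ M)%type := (e a ⊗ e b) ⊗ e c.

Lemma map12_e3 a b c : map12 R (e3 a b c) = \sum_p \sum_q X q b p a *: e3 p q c.
Proof.
rewrite /map12 /e3 tmapE R_basis linear_sumlz; apply: eq_bigr => p _.
by rewrite linear_sumlz; apply: eq_bigr => q _; rewrite linearZl_LR.
Qed.

Lemma map23_e3 a b c : map23 R (e3 a b c) = \sum_p \sum_q X q c p b *: e3 a p q.
Proof.
rewrite /map23 /e3 /= tassocE tmapE R_basis linear_sumr linear_sum /=.
apply: eq_bigr => p _; rewrite linear_sumr linear_sum /=.
by apply: eq_bigr => q _; rewrite linearZr_LR linearZ /= tassocVE.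
Qed.

Lemma map23_flip_e3 a b c : map23 (@tflip k M M) (e3 a b c) = e3 a c b.
Proof. by rewrite /map23 /e3 /= tassocE tmapE /= tflipE tassocVE. Qed.

Lemma map13_e3 a b c : map13 R (e3 a b c) = \sum_p \sum_q X q c p a *: e3 p b q.
Proof.
rewrite /map13 /= map23_flip_e3 map12_e3 linear_sum; apply: eq_bigr => p _.
rewrite linear_sum; apply: eq_bigr => q _ /=.
by rewrite linearZ /= map23_flip_e3.
Qed.

Definition co3 r t w (x : ((M ⊗ M) ⊗ M)%type) : k :=
  co r (tcoordr M t (tcoordr (M ⊗ M)%type w x)).

Lemma co3_linear r t w : scalar (co3 r t w).
Proof. by move=> a x y; rewrite /co3 !linearP. Qed.
HB.instance Definition _ r t w := GRing.isLinear.Build k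
  ((M ⊗ M) ⊗ M)%type k *%R (co3 r t w) (co3_linear r t w).

Lemma co3_e3 r t w a b c :
  co3 r t w (e3 a b c) = (r == a)%:R * (t == b)%:R * (w == c)%:R.
Proof.
rewrite /co3 /e3 tcoordrE base.1 linearZ_LR tcoordrE base.1.
by rewrite !linearZ /= base.1 mulrC [_ * (r == a)%:R]mulrC.
Qed.

Lemma co3_map12 r t w a b c :
  co3 r t w (map12 R (e3 a b c)) = (w == c)%:R * X t b r a.
Proof.
rewrite map12_e3 linear_sum -[X t b r a](sum_deltal (fun p => X t b p a))
  mulr_sumr; apply: eq_bigr => p _.
rewrite linear_sum -[X t b p a](sum_deltal (fun q => X q b p a))
  !mulr_sumr; apply: eq_bigr => q _.
by rewrite linearZ /= co3_e3; ring.
Qed.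

Lemma co3_map23 r t w a b c :
  co3 r t w (map23 R (e3 a b c)) = (r == a)%:R * X w c t b.
Proof.
rewrite map23_e3 linear_sum -[X w c t b](sum_deltal (fun p => X w c p b))
  mulr_sumr; apply: eq_bigr => p _.
rewrite linear_sum -[X w c p b](sum_deltal (fun q => X q c p b))
  !mulr_sumr; apply: eq_bigr => q _.
by rewrite linearZ /= co3_e3; ring.
Qed.

Lemma co3_map13 r t w a b c :
  co3 r t w (map13 R (e3 a b c)) = (t == b)%:R * X w c r a.
Proof.
rewrite map13_e3 linear_sum -[X w c r a](sum_deltal (fun p => X w c p a))
  mulr_sumr; apply: eq_bigr => p _.
rewrite linear_sum -[X w c p a](sum_deltal (fun q => X q c p a))
  !mulr_sumr; apply: eq_bigr => q _.
by rewrite linearZ /= co3_e3; ring.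
Qed.

Lemma co3_lin r t w (f : {linear ((M ⊗ M) ⊗ M)%type -> ((M ⊗ M) ⊗ M)%type})
    (F : 'I_n -> 'I_n -> k) (g : 'I_n -> 'I_n -> ((M ⊗ M) ⊗ M)%type) :
  co3 r t w (f (\sum_p \sum_q F p q *: g p q)) =
  \sum_p \sum_q F p q * co3 r t w (f (g p q)).
Proof.
rewrite linear_sum linear_sum; apply: eq_bigr => p _.
rewrite linear_sum linear_sum; apply: eq_bigr => q _.
by rewrite linearZ_LR linearZ.
Qed.

Hypothesis hopfR : hopf_equation R.

(** The (r, a) entry is the coefficient of e_r ⊗ e_i ⊗ e_j in the Hopf equation applied to e_a ⊗ e_l
    ⊗ e_u. *)
Lemma rmx_hopf i j u l :
  \sum_p \sum_q X j p i q *: (X p u * X q l) = \sum_p X j u p l *: X i p.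
Proof.
apply/matrixP => r a; rewrite !summxE.
have := congr1 (co3 r i j) (hopfR (e3 a l u)); rewrite /= map12_e3 map23_e3.
rewrite -[map23 R (map13 R _)]/((map23 R \o map13 R) _) !co3_lin => hR.
(* The middle term is the coefficient of R^12 R^23 with R^12 not yet expanded; the left side reaches
   it through [hR]. *)
transitivity (\sum_p \sum_q X q u p l * co3 r i j (map12 R (e3 a p q))).
  rewrite -hR; under eq_bigr => p _ do rewrite summxE.
  under [RHS]eq_bigr => p _ do under eq_bigr => q _ do rewrite /= map13_e3 co3_lin.
  rewrite exchange_big [RHS]exchange_big; apply: eq_bigr => q _ /=.
  transitivity (\sum_p \sum_s X j s i q * (X s u r p * X q l p a)).
    rewrite exchange_big; apply: eq_bigr => s _ /=; rewrite mxE -mulr_sumr.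
    by congr (_ * _); rewrite mxE.
  apply: eq_bigr => p _; rewrite exchange_big mulr_sumr; apply: eq_bigr => s _ /=.
  under eq_bigr => r' _ do rewrite co3_map23 mulrCA.
  by rewrite sum_deltal; ring.
apply: eq_bigr => p _.
under eq_bigr => q _ do rewrite co3_map12 mulrCA.
by rewrite sum_deltal [RHS]mxE.
Qed.

(** R^12 acts on the first leg by X_pu while moving the second from e_u to e_p, and R^13 acts on it
    by X_qv while moving the third from e_v to e_q. *)
Lemma rmx_comm : is_commutative R -> forall p q u v, X p u * X q v = X q v * X p u.
Proof.
move=> commR p q u v; apply/matrixP => r a.
have := congr1 (co3 r p q) (commR (e3 a u v)); rewrite /= map12_e3 map13_e3 !co3_lin.
under eq_bigr => i _ do under eq_bigr => j _ do rewrite co3_map12 mulrCA.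
under [RHS]eq_bigr => i _ do under eq_bigr => j _ do rewrite co3_map13 mulrCA.
under eq_bigr => i _ do rewrite sum_deltal mulrC.
under [RHS]eq_bigr => i _ do rewrite sum_deltal mulrC.
by rewrite !mxE.
Qed.

End Operator13.
End Basis.

(** * The bialgebra of a solution of the Hopf equation *)

Section HopfRelations.
Variables (k : fieldType) (n : nat) (X : 'I_n -> 'I_n -> 'M[k]_n).
Notation G := ('I_n * 'I_n)%type.

Definition hopf_lhs (i j u l : 'I_n) : term k G :=
  \big[@Add k G/Const G 0]_p \big[@Add k G/Const G 0]_q
    Mul (Const G (X j p i q)) (Mul (Gen k (p, u)) (Gen k (q, l))).

Definition hopf_rhs (i j u l : 'I_n) : term k G :=
  \big[@Add k G/Const G 0]_p Mul (Const G (X j u p l)) (Gen k (i, p)).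

(** The flag [comm] lets one construction produce both B(R) and its commutative version. *)
Inductive hopf_rel (comm : bool) : term k G -> term k G -> Prop :=
| HopfRel i j u l : hopf_rel comm (hopf_lhs i j u l) (hopf_rhs i j u l)
| CommRel p q : comm -> hopf_rel comm (Mul (Gen k p) (Gen k q)) (Mul (Gen k q) (Gen k p)).

Section Eval.
Variables (A : pzRingType) (iota : {rmorphism k -> A}) (g : G -> A).

Lemma eval_hopf_lhs i j u l : eval iota g (hopf_lhs i j u l) =
  \sum_p \sum_q iota (X j p i q) * (g (p, u) * g (q, l)).
Proof. by rewrite eval_sum; apply: eq_bigr => p _; rewrite eval_sum. Qed.

Lemma eval_hopf_rhs i j u l :
  eval iota g (hopf_rhs i j u l) = \sum_p iota (X j u p l) * g (i, p).
Proof. by rewrite eval_sum. Qed.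

Lemma eval_hopf_rel (comm : bool) :
    (forall i j u l, \sum_p \sum_q iota (X j p i q) * (g (p, u) * g (q, l)) =
       \sum_p iota (X j u p l) * g (i, p)) ->
    (comm -> forall p q, g p * g q = g q * g p) ->
  forall s t, hopf_rel comm s t -> eval iota g s = eval iota g t.
Proof.
move=> gX gC s t [i j u l|p q c] /=; last exact: gC.
by rewrite eval_hopf_lhs eval_hopf_rhs.
Qed.
End Eval.

Variable comm : bool.

(** Replacing c_ij by the Kronecker delta turns both sides of the relation into X_ju(i, l). *)
Lemma hopf_rel_eps s t : hopf_rel comm s t ->
  eval idfun (@comatrix_eps k n) s = eval idfun (@comatrix_eps k n) t.
Proof.
apply: eval_hopf_rel => [i j u l|_ p q]; last exact: mulrC.
rewrite /comatrix_eps /=.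
under eq_bigr => p _ do
  (under eq_bigr => q _ do rewrite mulrA; rewrite sum_deltar).
rewrite sum_deltar; under eq_bigr => p _ do rewrite mulrC.
by rewrite sum_deltal.
Qed.

Notation B0 := (presented hopf_rel_eps).
Notation c i j := (gen hopf_rel_eps (i, j)).

Lemma gen_hopf i j u l :
  \sum_p \sum_q X j p i q *: (c p u * c q l) = \sum_p X j u p l *: c i p.
Proof.
have := gen_rel hopf_rel_eps (HopfRel comm i j u l).
rewrite eval_hopf_lhs eval_hopf_rhs => E.
transitivity (\sum_p \sum_q in_alg B0 (X j p i q) * (c p u * c q l)).
  by apply: eq_bigr => p _; apply: eq_bigr => q _; rewrite mulr_algl.
by rewrite E; apply: eq_bigr => p _; rewrite mulr_algl.
Qed.

Lemma gen_comm : comm -> commutative ( *%R : B0 -> B0 -> B0).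
Proof.
move=> Hc.
have genC p q : gen hopf_rel_eps p * gen hopf_rel_eps q =
    gen hopf_rel_eps q * gen hopf_rel_eps p.
  exact: (gen_rel hopf_rel_eps (CommRel p q Hc)).
have C p y : gen hopf_rel_eps p * y = y * gen hopf_rel_eps p.
  elim/presented_ind: y => [//|a|x y Ex Ey|x y Ex Ey].
  - by rewrite mulr_algl mulr_algr.
  - by rewrite mulrDl mulrDr Ex Ey.
  - by rewrite mulrA Ex -mulrA Ey mulrA.
move=> x y; elim/presented_ind: x => [//|a|x z Ex Ez|x z Ex Ez].
- by rewrite mulr_algl mulr_algr.
- by rewrite mulrDl mulrDr Ex Ez.
- by rewrite -mulrA Ez mulrA Ex mulrA.
Qed.

(* Delta(lhs) = sum lhs' ⊗ c c = sum c ⊗ lhs'' = sum c ⊗ rhs = Delta(rhs). *)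
Lemma hopf_rel_delta s t : hopf_rel comm s t ->
  eval (tconst B0 B0) (comatrix_delta hopf_rel_eps) s =
  eval (tconst B0 B0) (comatrix_delta hopf_rel_eps) t.
Proof.
apply: eval_hopf_rel => [i j u l|Hc [p u] [q l]]; rewrite /comatrix_delta /=; last first.
  rewrite !big_distrlr /=.
  rewrite exchange_big; apply: eq_bigr => a _; apply: eq_bigr => b _ /=.
  by rewrite !tensor_mulE; congr (_ ⊗ _); exact: gen_comm.
(* Grouping by the second factor c_au c_bl exhibits in the first factor the left side of the
   relation with indices i, j, a, b. *)
transitivity (\sum_a \sum_b
    (\sum_p \sum_q X j p i q *: (c p a * c q b)) ⊗ (c a u * c b l)).
  under eq_bigr => p _.
    under eq_bigr => q _.
      rewrite big_distrlr tconstE scaler_sumr /=.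
      under eq_bigr => a _.
        rewrite scaler_sumr.
        under eq_bigr => b _ do rewrite tensor_mulE -linearZl_LR.
        over.
      over.
    rewrite exchange_big; under eq_bigr => a _ do rewrite exchange_big.
    over.
  rewrite exchange_big; apply: eq_bigr => a _ /=.
  rewrite exchange_big; apply: eq_bigr => b _ /=.
  rewrite linear_sumlz; apply: eq_bigr => p _.
  by rewrite linear_sumlz.
transitivity (\sum_a \sum_b (\sum_r X j a r b *: c i r) ⊗ (c a u * c b l)).
  by apply: eq_bigr => a _; apply: eq_bigr => b _; rewrite gen_hopf.
(* Regrouping by c_ir exhibits in the second factor the left side of the relation with indices r, j,
   u, l. *)
transitivity (\sum_r c i r ⊗ (\sum_a \sum_b X j a r b *: (c a u * c b l))).
  under eq_bigr => a _.
    under eq_bigr => b _ do rewrite linear_sumlz.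
    rewrite exchange_big; over.
  rewrite exchange_big; apply: eq_bigr => r _ /=.
  rewrite linear_sumr; apply: eq_bigr => a _.
  rewrite linear_sumr; apply: eq_bigr => b _.
  by rewrite linearZl_LR linearZr_LR.
transitivity (\sum_r \sum_p c i r ⊗ (X j u p l *: c r p)).
  by apply: eq_bigr => r _; rewrite gen_hopf linear_sumr.
rewrite exchange_big; apply: eq_bigr => r _ /=.
rewrite tconstE scaler_sumr; apply: eq_bigr => a _.
by rewrite linearZr_LR.
Qed.

Definition hopf_bialgebra : bialgType k := comatrix_bialgebra hopf_rel_delta.

End HopfRelations.

(** * Hopf modules in terms of the coefficients of the coaction *)

Section Coefficients.
Variables (k : fieldType) (M : lmodType k) (n : nat).
Variables (e : 'I_n -> M) (co : 'I_n -> {scalar M}).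
Hypothesis base : dual_bases e co.
Variable R : {linear (M ⊗ M)%type -> (M ⊗ M)%type}.
Notation X := (rmx e co R).

Lemma pure_basis x y :
  x ⊗ y = \sum_v \sum_u (co v x * co u y) *: (e v ⊗ e u).
Proof.
rewrite {1}(base.2 x) linear_sumlz; apply: eq_bigr => v _.
rewrite {1}(base.2 y) linear_sumr; apply: eq_bigr => u _.
by rewrite linearZl_LR linearZr_LR /= scalerA.
Qed.

Lemma tensor_basis_ext (V : lmodType k) (f g : {linear (M ⊗ M)%type -> V}) :
  (forall v u, f (e v ⊗ e u) = g (e v ⊗ e u)) -> f =1 g.
Proof.
move=> fg; apply: tensor_ext => [||x y]; [exact: linearP|exact: linearP|].
rewrite (pure_basis x y) !linear_sum; apply: eq_bigr => v _.
by rewrite !linear_sum; apply: eq_bigr => u _; rewrite !linearZ_LR fg.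
Qed.

Section Compare.
Variables (H : bialgType k) (act : {bilinear H -> M -> M}).
Variables (rho : {linear M -> (M ⊗ H)%type}) (c : 'I_n -> 'I_n -> H).
Hypothesis rho_e : forall l, rho (e l) = \sum_v e v ⊗ c v l.

Lemma hopf_module_map_basis v u :
  hopf_module_map act rho (e v ⊗ e u) = \sum_j act (c j u) (e v) ⊗ e j.
Proof.
pose bil := hopf_module_map_bilinear1 act (e v).
rewrite hopf_module_mapE -[tlift _]/(tlift_lin bil : _ -> _) rho_e linear_sum.
by apply: eq_bigr => j _; exact: tlift_linE.
Qed.

(** In R (e_v ⊗ e_u) the coefficient of e_j in the second factor is c_ju . e_v, so R determines how
    the coefficients act. *)
Lemma act_coef : R =1 hopf_module_map act rho ->
  forall j u v, act (c j u) (e v) = \sum_i X j u i v *: e i.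
Proof.
by move=> hR j u v; rewrite -(tcoordr_rmx base) hR hopf_module_map_basis
  (tcoordr_sum base).
Qed.

Hypothesis act_e : forall j u v, act (c j u) (e v) = \sum_i X j u i v *: e i.

Lemma hopf_module_map_coef : R =1 hopf_module_map act rho.
Proof.
apply: (tensor_basis_ext (g := tlift_lin (hopf_module_map_bilinear act rho))).
move=> v u; rewrite -[RHS]/(hopf_module_map act rho (e v ⊗ e u)).
rewrite hopf_module_map_basis.
rewrite (R_basis base) exchange_big; apply: eq_bigr => j _ /=.
rewrite act_e linear_sumlz; apply: eq_bigr => i _.
by rewrite linearZl_LR.
Qed.

(** This and [coact_coef] compute the two sides of Hopf compatibility at c_ju and e_l; the
    coefficients of e_i are the two sides of the relation. Both are used to prove compatibility over
    B(R) and to derive the relations over an arbitrary H. *)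
Lemma tact_coef j u l :
  tact act (\sum_p c j p ⊗ c p u) (\sum_q e q ⊗ c q l) =
  \sum_i e i ⊗ \sum_p \sum_q X j p i q *: (c p u * c q l).
Proof.
transitivity (\sum_p \sum_q \sum_i e i ⊗ (X j p i q *: (c p u * c q l))).
  rewrite linear_sumlz; apply: eq_bigr => p _.
  rewrite linear_sumr; apply: eq_bigr => q _.
  rewrite /= tactE act_e linear_sumlz; apply: eq_bigr => i _.
  by rewrite linearZl_LR linearZr_LR.
under eq_bigr => p _ do rewrite exchange_big.
rewrite exchange_big; apply: eq_bigr => i _ /=.
rewrite linear_sumr; apply: eq_bigr => p _.
by rewrite linear_sumr.
Qed.

Lemma coact_coef j u l :
  rho (act (c j u) (e l)) = \sum_i e i ⊗ \sum_p X j u p l *: c i p.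
Proof.
rewrite act_e linear_sum.
transitivity (\sum_p \sum_i e i ⊗ (X j u p l *: c i p)).
  apply: eq_bigr => p _; rewrite linearZ_LR rho_e scaler_sumr.
  by apply: eq_bigr => i _; rewrite linearZr_LR.
by rewrite exchange_big; apply: eq_bigr => i _ /=; rewrite linear_sumr.
Qed.

(** Coassociativity and the counit axiom at e_l are compared in the coefficient of e_i. *)
Lemma comodule_coef : is_right_comodule rho ->
  (forall i l, comul (c i l) = \sum_v c i v ⊗ c v l) /\
  (forall i l, counit (c i l) = (i == l)%:R).
Proof.
move=> [rhoA rho1]; split=> i l.
  have := congr1 (tcoordl co (H ⊗ H)%type i) (rhoA (e l)); rewrite rho_e.
  rewrite ![tmap _ _ (\sum_(_ < _) _)]linear_sum.
  have -> : \sum_v tmap idfun comul (e v ⊗ c v l) = \sum_v e v ⊗ comul (c v l).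
    by apply: eq_bigr => v _; rewrite tmapE.
  rewrite (tcoordl_sum base) => <-.
  have -> : tassoc (\sum_v tmap rho idfun (e v ⊗ c v l)) =
      \sum_w e w ⊗ \sum_v c w v ⊗ c v l.
    rewrite linear_sum; transitivity (\sum_v \sum_w e w ⊗ (c w v ⊗ c v l)).
      apply: eq_bigr => v _; rewrite tmapE rho_e linear_sumlz linear_sum.
      by apply: eq_bigr => w _; rewrite /= tassocE.
    by rewrite exchange_big; apply: eq_bigr => w _ /=; rewrite linear_sumr.
  by rewrite (tcoordl_sum base).
pose bil := scaler_bilinear M (counit : {scalar H}).
have E : \sum_v counit (c v l) *: e v = e l.
  rewrite -[RHS]rho1 -[tlift _]/(tlift_lin bil : _ -> _) rho_e linear_sum.
  by apply: eq_bigr => v _; rewrite tlift_linE.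
rewrite -base.1 -E linear_sum.
rewrite -[LHS](sum_deltar (fun v => counit (c v l))); apply: eq_bigr => v _.
by rewrite linearZ /= base.1 eq_sym.
Qed.

Lemma hopf_coef : hopf_compatible act rho ->
    (forall i l, comul (c i l) = \sum_v c i v ⊗ c v l) ->
  forall i j u l,
  \sum_p \sum_q X j p i q *: (c p u * c q l) = \sum_p X j u p l *: c i p.
Proof.
move=> compat Dc i j u l; have := compat (c j u) (e l).
rewrite -[RHS]/(tact act (comul (c j u)) (rho (e l))) coact_coef Dc rho_e tact_coef.
by move/(congr1 (tcoordl co H i)); rewrite !(tcoordl_sum base) => ->.
Qed.

End Compare.
End Coefficients.

(** * The Hopf module structure of M over the presented bialgebra *)

Section HopfBialgebra.
Variables (k : fieldType) (M : lmodType k) (n : nat).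
Variables (e : 'I_n -> M) (co : 'I_n -> {scalar M}).
Hypothesis base : dual_bases e co.
Variable R : {linear (M ⊗ M)%type -> (M ⊗ M)%type}.
Hypothesis hopfR : hopf_equation R.
Variable comm : bool.
Hypothesis commR : comm -> is_commutative R.
Notation X := (rmx e co R).
Notation B := (hopf_bialgebra X comm).
Notation c i j := (gen (@hopf_rel_eps k n X comm) (i, j) : B).

Definition hopf_rep (b : B) : 'M[k]_n :=
  quot_lift (@scalar_mx k n) (fun p => X p.1 p.2) b.

Lemma scalar_mx_central a (A : 'M[k]_n) : a%:M * A = A * a%:M.
Proof. exact: comm_scalar_mx. Qed.

(** The assumptions on R enter here: the Hopf equation gives the relations between the matrices
    X_ij, and commutativity of R gives the commutation relations when [comm] holds. *)
Lemma hopf_rep_rel s t : hopf_rel X comm s t ->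
  eval (@scalar_mx k n) (fun p => X p.1 p.2) s =
  eval (@scalar_mx k n) (fun p => X p.1 p.2) t.
Proof.
apply: eval_hopf_rel => [i j u l|Hc p q] /=; last first.
  exact: (rmx_comm base (commR Hc)).
transitivity (\sum_p \sum_q X j p i q *: (X p u * X q l)).
  by apply: eq_bigr => p _; apply: eq_bigr => q _; exact: mul_scalar_mx.
by rewrite (rmx_hopf base hopfR); apply: eq_bigr => p _; rewrite -mul_scalar_mx.
Qed.

Lemma hopf_rep_linear : linear hopf_rep.
Proof.
move=> a x y; rewrite /hopf_rep quot_liftD ?quot_liftZ ?[_ * _]mul_scalar_mx //.
all: by [exact: scalar_mx_central|exact: hopf_rep_rel].
Qed.

Lemma hopf_repM x y : hopf_rep (x * y) = hopf_rep x * hopf_rep y.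
Proof.
by apply: quot_liftM; [exact: scalar_mx_central|exact: hopf_rep_rel].
Qed.

Lemma hopf_rep1 : hopf_rep 1 = 1.
Proof.
by apply: quot_lift1; [exact: scalar_mx_central|exact: hopf_rep_rel].
Qed.

Lemma hopf_rep_gen i j : hopf_rep (c i j) = X i j.
Proof.
by apply: quot_lift_pi; [exact: scalar_mx_central|exact: hopf_rep_rel].
Qed.

Definition hopf_act (b : B) (m : M) : M := mxact e co (hopf_rep b) m.

Lemma hopf_act_bilinear : is_bilinear hopf_act.
Proof.
split=> [m a b b'|b] /=; last exact: (mxact_bilinear e co).2.
by rewrite /hopf_act hopf_rep_linear; exact: (mxact_bilinear e co).1.
Qed.

HB.instance Definition _ := bilinear_isBilinear.Build k B M M *:%R *:%R
  hopf_act hopf_act_bilinear.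

Definition hopf_action : {bilinear B -> M -> M} := hopf_act.

Lemma hopf_act1 m : hopf_act 1 m = m.
Proof. by rewrite /hopf_act hopf_rep1 (mxact1 base). Qed.

Lemma hopf_actM g h m : hopf_act (g * h) m = hopf_act g (hopf_act h m).
Proof. by rewrite /hopf_act hopf_repM (mxactM base). Qed.

Lemma hopf_act_gen j u v : hopf_act (c j u) (e v) = \sum_i X j u i v *: e i.
Proof. by rewrite /hopf_act hopf_rep_gen (mxact_basis base). Qed.

Definition hopf_coact (m : M) : (M ⊗ B)%type :=
  \sum_v e v ⊗ (\sum_l co l m *: c v l).

Lemma hopf_coact_linear : linear hopf_coact.
Proof.
move=> a x y; rewrite /hopf_coact scaler_sumr -big_split; apply: eq_bigr => v _ /=.
rewrite -linearPr; congr (_ ⊗ _); rewrite scaler_sumr -big_split.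
by apply: eq_bigr => l _ /=; rewrite linearP scalerDl scalerA.
Qed.

HB.instance Definition _ := GRing.isLinear.Build k M (M ⊗ B)%type *:%R
  hopf_coact hopf_coact_linear.

Lemma hopf_coact_basis l : hopf_coact (e l) = \sum_v e v ⊗ c v l.
Proof.
apply: eq_bigr => v _; congr (_ ⊗ _); rewrite (bigD1 l) //= base.1 eqxx scale1r.
rewrite big1 ?addr0 // => j jl.
by rewrite base.1 (negbTE jl) scale0r.
Qed.

Lemma comul_gen i j : comul (c i j) = \sum_u c i u ⊗ c u j.
Proof. exact: (pres_delta_gen (@hopf_rel_delta k n X comm)). Qed.

Lemma counit_gen i j : counit (c i j) = (i == j)%:R.
Proof. exact: (pres_eps_gen (@hopf_rel_eps k n X comm)). Qed.

Lemma hopf_comodule : is_right_comodule hopf_coact.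
Proof.
split.
  pose F : {linear M -> (M ⊗ (B ⊗ B))%type} :=
    (@tassoc k M B B \o tmap hopf_coact idfun) \o hopf_coact.
  pose G : {linear M -> (M ⊗ (B ⊗ B))%type} := tmap idfun comul \o hopf_coact.
  apply: (basis_ext base (f := F) (g := G)) => l.
  rewrite -[RHS]/(tmap idfun comul (hopf_coact (e l))).
  rewrite -[LHS]/(tassoc (tmap hopf_coact idfun (hopf_coact (e l)))).
  rewrite hopf_coact_basis ![tmap _ _ (\sum_(_ < _) _)]linear_sum.
  transitivity (\sum_v \sum_w e w ⊗ (c w v ⊗ c v l)).
    rewrite linear_sum; apply: eq_bigr => v _.
    rewrite /= tmapE /= hopf_coact_basis linear_sumlz linear_sum.
    by apply: eq_bigr => w _; rewrite /= tassocE.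
  rewrite exchange_big; apply: eq_bigr => w _.
  rewrite -[RHS]/(tmap idfun comul (e w ⊗ c w l)).
  by rewrite tmapE comul_gen linear_sumr.
pose bil := scaler_bilinear M (counit : {scalar B}).
pose F : {linear M -> M} := tlift_lin bil \o hopf_coact.
apply: (basis_ext base (f := F) (g := idfun)) => l.
rewrite /F /= hopf_coact_basis -[tlift _]/(tlift_lin bil : _ -> _) linear_sum.
rewrite (bigD1 l) // big1 => [|v vl]; rewrite tlift_linE counit_gen.
  by rewrite eqxx scale1r /= addr0.
by rewrite (negbTE vl) scale0r.
Qed.

(** The set of h satisfying compatibility for all m is a subalgebra, by [tact1] and [tactM]; it
    contains the generators by [gen_hopf]. *)
Lemma hopf_compat : hopf_compatible hopf_act hopf_coact.
Proof.
move=> h; elim/presented_ind: h => [[j u]|a|x y Ex Ey|x y Ex Ey] m.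
- pose F : {linear M -> (M ⊗ B)%type} :=
    hopf_coact \o (hopf_act : {bilinear B -> M -> M}) (c j u).
  pose G : {linear M -> (M ⊗ B)%type} :=
    (tact hopf_act : {bilinear (B ⊗ B)%type -> (M ⊗ B)%type -> (M ⊗ B)%type})
      (comul (c j u)) \o hopf_coact.
  apply: (basis_ext base (f := F) (g := G)) => l; rewrite /F /G /=.
  rewrite (coact_coef hopf_coact_basis hopf_act_gen).
  rewrite comul_gen hopf_coact_basis (tact_coef hopf_act_gen).
  by apply: eq_bigr => i _; rewrite gen_hopf.
- rewrite -[RHS]/(tact hopf_act (comul (a%:A : B)) (hopf_coact m)).
  rewrite linearZ /= (comul_monoid_morphism (s := B)).1 !linearZl_LR /= hopf_act1.
  by rewrite linearZ_LR (tact1 hopf_act1).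
- rewrite -[RHS]/(tact hopf_act (comul (x + y : B)) (hopf_coact m)).
  by rewrite linearD !linearDl linearD /= Ex Ey.
- have {}Ex m' : hopf_coact (hopf_act x m') =
    tact hopf_act (comul (x : B)) (hopf_coact m') := Ex m'.
  have {}Ey m' : hopf_coact (hopf_act y m') =
    tact hopf_act (comul (y : B)) (hopf_coact m') := Ey m'.
  rewrite -[RHS]/(tact hopf_act (comul ((x : B) * (y : B))) (hopf_coact m)).
  rewrite (comul_monoid_morphism (s := B)).2 (tactM hopf_actM) -Ey -Ex.
  by rewrite -hopf_actM.
Qed.

Lemma hopf_is_hopf_module : is_hopf_module hopf_act hopf_coact.
Proof.
split; [split|exact: hopf_comodule|exact: hopf_compat].
- exact: hopf_act1.
- exact: hopf_actM.
Qed.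

Lemma hopf_map : R =1 hopf_module_map hopf_act hopf_coact.
Proof. exact: (hopf_module_map_coef base hopf_coact_basis hopf_act_gen). Qed.

End HopfBialgebra.

(** * Universality *)

Section Universality.
Variables (k : fieldType) (M : lmodType k) (n : nat).
Variables (e : 'I_n -> M) (co : 'I_n -> {scalar M}).
Hypothesis base : dual_bases e co.
Variable R : {linear (M ⊗ M)%type -> (M ⊗ M)%type}.
Hypothesis hopfR : hopf_equation R.
Notation X := (rmx e co R).
Notation B := (hopf_bialgebra X false).
Notation c i j := (gen (@hopf_rel_eps k n X false) (i, j) : B).
Variables (H : bialgType k) (act : {bilinear H -> M -> M}).
Variable rho : {linear M -> (M ⊗ H)%type}.
Hypothesis hopfM : is_hopf_module act rho.
Hypothesis R_map : R =1 hopf_module_map act rho.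

Definition coact_coord (p : 'I_n * 'I_n) : H := tcoordl co H p.1 (rho (e p.2)).
Notation d i j := (coact_coord (i, j)).

Lemma coact_coordE l : rho (e l) = \sum_v e v ⊗ d v l.
Proof. exact: (tensor_coordl base). Qed.

Lemma coact_coord_act j u v : act (d j u) (e v) = \sum_i X j u i v *: e i.
Proof. exact: (act_coef base coact_coordE R_map). Qed.

Lemma comul_coord i l : comul (d i l) = \sum_v d i v ⊗ d v l.
Proof. by case: hopfM => _ coM _; have [-> _] := comodule_coef base coact_coordE coM. Qed.

Lemma counit_coord i l : counit (d i l) = (i == l)%:R.
Proof. by case: hopfM => _ coM _; have [_ ->] := comodule_coef base coact_coordE coM. Qed.

(** The relations are consequences of the Hopf module axioms over H, so c_ij -> d_ij is well defined
    on B(R). *)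
Lemma coact_coord_rel s t : hopf_rel X false s t ->
  eval (in_alg H) coact_coord s = eval (in_alg H) coact_coord t.
Proof.
case: hopfM => _ _ compat.
apply: eval_hopf_rel => [i j u l|//].
have := hopf_coef base coact_coordE coact_coord_act compat comul_coord i j u l.
move=> E; transitivity (\sum_p \sum_q X j p i q *: (d p u * d q l)).
  by apply: eq_bigr => p _; apply: eq_bigr => q _; exact: mulr_algl.
by rewrite E; apply: eq_bigr => p _; rewrite mulr_algl.
Qed.

Definition univ (b : B) : H := quot_lift (in_alg H) coact_coord b.

Lemma in_algC (a : k) (x : H) : in_alg H a * x = x * in_alg H a.
Proof. by rewrite mulr_algl mulr_algr. Qed.

Lemma univ_linear : linear univ.
Proof.
move=> a x y; rewrite /univ quot_liftD ?quot_liftZ ?mulr_algl //.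
all: by [exact: in_algC|exact: coact_coord_rel].
Qed.

HB.instance Definition _ := GRing.isLinear.Build k B H *:%R univ univ_linear.

Definition univ_map : {linear B -> H} := univ.

Lemma univ_monoid : monoid_morphism univ.
Proof.
split=> [|x y]; [apply: quot_lift1|apply: quot_liftM].
all: by [exact: in_algC|exact: coact_coord_rel].
Qed.

Lemma univ_gen i j : univ (c i j) = d i j.
Proof. by apply: quot_lift_pi; [exact: in_algC|exact: coact_coord_rel]. Qed.

(** The c_ij and the d_ij obey the same comatrix formulas, and all the maps compared are
    multiplicative. *)
Lemma univ_bialgebra : is_bialgebra_map univ.
Proof.
have [u1 uM] := univ_monoid; have [t1 tM] := tmap_monoid univ_monoid univ_monoid.
have [D1 DM] := comul_monoid_morphism (s := B).
have [D'1 D'M] := comul_monoid_morphism (s := H).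
have [e1 eM] := counit_monoid_morphism (s := B).
have [e'1 e'M] := counit_monoid_morphism (s := H).
split=> //; split.
  pose F : {linear B -> (H ⊗ H)%type} := comul \o univ.
  pose G : {linear B -> (H ⊗ H)%type} := tmap univ univ \o comul.
  apply: (presented_ext (f := F) (g := G)
    (mul := fun x y : (H ⊗ H)%type => x * y)) => [|x y|x y|[i j]].
  - by rewrite /F /G /= u1 D'1 -[pres_delta _]/(comul (1 : B)) D1 t1.
  - by rewrite /F /= uM D'M.
  - by rewrite /G -[LHS]/(tmap univ univ (comul ((x : B) * (y : B)))) DM tM.
  rewrite -[LHS]/(comul (univ (c i j))) univ_gen comul_coord.
  rewrite -[RHS]/(tmap univ univ (comul (c i j))) comul_gen linear_sum.
  by apply: eq_bigr => v _; rewrite /= tmapE /= !univ_gen.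
rewrite -[forall h, _]/(forall h : B, counit (univ h) = counit h).
elim/presented_ind => [[i j]|a|x y Ex Ey|x y Ex Ey].
- by rewrite univ_gen counit_coord counit_gen.
- by rewrite !linearZ /= u1 e'1 -[pres_eps _ _]/(counit (1 : B)) e1.
- by rewrite !linearD /= Ex Ey.
- by rewrite uM e'M Ex Ey -eM.
Qed.

Lemma univ_coact : rho =1 tmap idfun univ \o hopf_coact e co R false.
Proof.
pose G : {linear M -> (M ⊗ H)%type} := tmap idfun univ \o hopf_coact e co R false.
apply: (basis_ext base (g := G)) => l.
rewrite coact_coordE /G /= (hopf_coact_basis base) linear_sum.
by apply: eq_bigr => v _; rewrite /= tmapE /= univ_gen.
Qed.

(** The coefficient of e_i in the coaction equation at e_j forces g to send c_ij to d_ij. *)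
Lemma univ_unique (g : {linear B -> H}) : is_bialgebra_map g ->
  rho =1 tmap idfun g \o hopf_coact e co R false -> g =1 univ.
Proof.
move=> [[g1 gM] _] rho_g; have [u1 uM] := univ_monoid.
apply: (presented_ext (f := g) (g := univ)
  (mul := fun x y : H => x * y)) => [|x y|x y|[i j]] //.
- exact: etrans g1 (esym u1).
rewrite [RHS]univ_gen /coact_coord rho_g /= (hopf_coact_basis base) linear_sum.
rewrite -(tcoordl_sum base (fun v => g (c v j)) i); congr (tcoordl _ _ _ _).
by apply: eq_bigr => v _; rewrite /= tmapE.
Qed.

(** R forces c_ij and d_ij to act on M by the same matrix X_ij, and both sides are actions of
    B(R). *)
Lemma univ_act (a : B) (m : M) : hopf_act a m = act (univ a) m.
Proof.
have commR : false -> is_commutative R by [].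
case: hopfM => [[act1 actM] _ _]; have [u1 uM] := univ_monoid.
elim/presented_ind: a m => [[i j]|a|x y Ex Ey|x y Ex Ey] m.
- apply: (basis_ext base
    (f := hopf_action base hopfR commR (c i j))
    (g := act (univ (c i j)))) => l.
  rewrite -[LHS]/(hopf_act (c i j) (e l)) univ_gen.
  by rewrite (hopf_act_gen base hopfR commR) -coact_coord_act.
- rewrite linearZ linearZl_LR /= linearZl_LR (hopf_act1 base hopfR commR).
  by rewrite u1 act1.
- by rewrite linearD !linearDl /= Ex Ey.
- rewrite -[LHS]/(hopf_act ((x : B) * (y : B)) m) (hopf_actM base hopfR commR).
  by rewrite Ey Ex uM actM.
Qed.

End Universality.

Theorem theorem4p1 (k : fieldType) (M : vectType k)
    (R : {linear (M ⊗ M)%type -> (M ⊗ M)%type}) (hR : hopf_equation R) :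
  (exists (B : bialgType k) (act : {bilinear B -> M -> M})
      (rho : {linear M -> (M ⊗ B)%type}),
    [/\ is_hopf_module act rho,
        R =1 hopf_module_map act rho &
        forall (H : bialgType k) (act' : {bilinear H -> M -> M})
          (rho' : {linear M -> (M ⊗ H)%type}),
        is_hopf_module act' rho' -> R =1 hopf_module_map act' rho' ->
        exists f : {linear B -> H},
          [/\ is_bialgebra_map f,
              rho' =1 tmap idfun f \o rho,
              forall g : {linear B -> H}, is_bialgebra_map g ->
                rho' =1 tmap idfun g \o rho -> g =1 f &
              forall (a : B) (m : M), act a m = act' (f a) m]]) /\
  (is_commutative R ->
    exists (B : bialgType k) (act : {bilinear B -> M -> M})
      (rho : {linear M -> (M ⊗ B)%type}),
    [/\ commutative ( *%R : B -> B -> B),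
        is_hopf_module act rho &
        R =1 hopf_module_map act rho]).
Proof.
pose n := \dim (fullv : {vspace M}).
pose e (i : 'I_n) : M := (vbasis fullv)`_i.
pose co (i : 'I_n) : {scalar M} := coord (vbasis (fullv : {vspace M})) i.
have base : dual_bases e co.
  split=> [i j|m]; last by apply: coord_vbasis; exact: memvf.
  by rewrite /co /e /= coord_free ?(basis_free (vbasisP _)) 1?eq_sym.
split=> [|commR].
  (* Without commutation relations, the commutativity condition on R is vacuous. *)
  have C : false -> is_commutative R by [].
  exists (hopf_bialgebra (rmx e co R) false),
    (hopf_action base hR C), (@hopf_coact k M n e co R false).
  split=> [||H act' rho' hM hR'].
  - exact: hopf_is_hopf_module.
  - exact: hopf_map.
  exists (univ_map base hM hR'); split.
  - exact: univ_bialgebra.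
  - exact: (univ_coact base hM hR').
  - by move=> g; apply: (univ_unique base hM hR').
  - exact: (univ_act base hR hM hR').
have C : true -> is_commutative R by [].
exists (hopf_bialgebra (rmx e co R) true),
  (hopf_action base hR C), (@hopf_coact k M n e co R true).
split.
- exact: gen_comm.
- exact: hopf_is_hopf_module.
- exact: hopf_map.
Qed.
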